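(* Let $d\geq 2$, let $\mathcal{P}$ be a finite classical polar space of rank $d+2$ with parameter $e\leq 1$ over $\mathbb{F}_q$ naturally embedded in $\mathrm{PG}(n+3,q)$, and let $\alpha\cong\mathrm{PG}(n,q)$ be an $(n+1)$-dimensional (vector dimension) subspace of $\mathrm{PG}(n+3,q)$ that intersects $\mathcal{P}$ in a polar space $\mathcal{P}'$ of rank $d$ with parameter $e+1$. Thus one of the following holds: $n=2d$, $\mathcal{P}=\mathcal{Q}^+(2d+3,q)$, $\mathcal{P}'=\mathcal{Q}(2d,q)$; or $n=2d$, $q$ is a square, $\mathcal{P}=\mathcal{H}(2d+3,q)$, $\mathcal{P}'=\mathcal{H}(2d,q)$; or $n=2d+1$, $\mathcal{P}=\mathcal{Q}(2d+4,q)$, $\mathcal{P}'=\mathcal{Q}^-(2d+1,q)$. Let $\mathcal{M}$ be a regular $(m,d-1)$-ovoid of type $1$ in $\mathcal{P}'$. Let $\mathcal{L}$ be the set of generators of $\mathcal{P}$ that meet $\alpha$ in a subspace of dimension $d-1$ which is an element of $\mathcal{M}$. Then $\mathcal{L}$ is a Cameron-Liebler set of generators in $\mathcal{P}$ with parameter $mq^{e+1}(q-1)$.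
   Context: All dimensions are vector space dimensions; an $a$-space is a totally isotropic (totally singular) subspace of dimension $a$. The finite classical polar spaces of rank $D$ over $\mathbb{F}_q$ are the hyperbolic quadric $\mathcal{Q}^+(2D-1,q)$, the Hermitian space $\mathcal{H}(2D-1,q)$ ($q$ a square), the symplectic space $\mathcal{W}(2D-1,q)$, the parabolic quadric $\mathcal{Q}(2D,q)$, the Hermitian space $\mathcal{H}(2D,q)$ ($q$ a square) and the elliptic quadric $\mathcal{Q}^-(2D+1,q)$, with parameter $e=0,\tfrac12,1,1,\tfrac32,2$ respectively; the first number in parentheses is the projective dimension of the ambient space. Generators are the $D$-spaces; through each $(D-1)$-space there are $q^e+1$ generators. $\Omega_a$ denotes the set of $a$-spaces, $\boldsymbol{j}$ an all-ones vector, $\qquad{n \brack k}_q$ the Gaussian binomial coefficient. For a polar space of rank $D$, let $C_{a,b}:\mathbb{R}^{\Omega_a}\to\mathbb{R}^{\Omega_b}$ be the incidence map (matrix with rows indexed by $b$-spaces, columns by $a$-spaces, entry 1 if one contains the other, 0 otherwise; $C_{a,b}=0$ if $a$ or $b$ is not in $\{0,\dots,D\}$). For $0\le r\le a$, $0\le i\le\min(r,D-a)$ put $V^a_{r,i}=\mathrm{Im}(C_{r,a})\cap\mathrm{Im}(C_{r-1,a})^\perp\cap\mathrm{Im}(C_{D-i,a})\cap\mathrm{Im}(C_{D-i+1,a})^\perp$; then $V^a_{0,0}=\langle\boldsymbol{j}\rangle$ and $\mathbb{R}^{\Omega_a}$ is the orthogonal direct sum of the $V^a_{r,i}$. Cameron-Liebler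 sets. In a polar space of rank $D$ put $V_r=V^D_{r,0}$, so $V_0=\langle\boldsymbol{j}\rangle$ and $V_1=\mathrm{Im}(C_{1,D})\cap\langle\boldsymbol{j}\rangle^\perp$. Let $K$ be the $(0,1)$-matrix on generators with entry 1 exactly when two generators intersect trivially. $V_1$ is contained in an eigenspace $V$ of $K$. A set $\mathcal{L}\subseteq\Omega_D$ of generators is a Cameron-Liebler set if its characteristic vector lies in $V_0\oplus V$. Its parameter is $x=|\mathcal{L}|/\prod_{i=0}^{D-2}(q^{e+i}+1)$ (here $D=d+2$). Regular ovoids. In the polar space $\mathcal{P}'$ (rank $d$), a set $\mathcal{M}\subseteq\Omega_{d-1}$ is an $(m,d-1)$-ovoid if every generator of $\mathcal{P}'$ contains exactly $m$ elements of $\mathcal{M}$; it is trivial if it is $\emptyset$ or $\Omega_{d-1}$. It is regular if there are constants $c_1,c_2$ such that for each $\pi\in\Omega_{d-1}$ the number of $\rho\in\mathcal{M}$ with $\dim(\rho\cap\pi)=d-2$ and $\langle\rho,\pi\rangle$ not a generator of $\mathcal{P}'$ equals $c_1$ if $\pi\in\mathcal{M}$ and $c_2$ if $\pi\notin\mathcal{M}$. A non-trivial regular $(m,d-1)$-ovoid has type $r$ if its characteristic vector lies in $V^{d-1}_{0,0}\oplus V^{d-1}_{r,1}$ (computed in $\mathcal{P}'$). In particular, for type $1$ in $\mathcal{P}'$ (which has parameter $e+1$) one has $c_2=mq^{e+1}(q-1)$ and $c_1=(m-1)q^{e+1}(q-1)+q^{e+2}\frac{q^{d-1}-1}{q-1}$.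 *)

(* Defs.v *)
From HB Require Import structures.
From mathcomp Require Import all_boot all_order all_algebra.
From mathcomp Require Import reals exp.

Set Implicit Arguments.
Unset Strict Implicit.
Unset Printing Implicit Defensive.

Import Order.TTheory GRing.Theory Num.Theory.
Local Open Scope ring_scope.

(* The subspaces of a space over a finite field form a finite type, so that
   sets of subspaces can be counted and summed over. *)
Section FiniteSubspaces.
Import VectorInternalTheory.
Variables (F : finFieldType) (vT : vectType F).
HB.instance Definition _ := [Countable of {vspace vT} by <:].
HB.instance Definition _ := [Finite of {vspace vT} by <:].
End FiniteSubspaces.

Section RealFunctions.

Variables (R : realType).

Section Dot.
Variable I : finType.

Definition ffdot (u v : {ffun I -> R^o}) : R := \sum_i u i * v i.

Fact ffdot_bilinear : bilinear_for *%R (idfun \; *%R) ffdot.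
Proof.
split=> w a u v; rewrite /ffdot /= mulr_sumr -big_split /=;
  apply: eq_bigr => i _; rewrite !ffunE.
  by rewrite mulrDl -mulrA.
by rewrite mulrDr mulrCA.
Qed.

HB.instance Definition _ := bilinear_isBilinear.Build R
  {ffun I -> R^o} {ffun I -> R^o} R *%R (idfun \; *%R) ffdot ffdot_bilinear.

Fact ffdot_sym u v : ffdot u v = (-1) ^+ false * idfun (ffdot v u).
Proof. by rewrite mul1r; apply: eq_bigr => i _; rewrite mulrC. Qed.

HB.instance Definition _ := isHermitianSesquilinear.Build R
  {ffun I -> R^o} false idfun ffdot ffdot_sym.

Definition orthocompl (U : {vspace {ffun I -> R^o}}) : {vspace {ffun I -> R^o}} :=
  orthov (ffdot : {symmetric {ffun I -> R^o}}) U.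

End Dot.

Section RelMap.
Variables I J : finType.

(* Multiplication of column vectors by the (0,1)-matrix, with rows indexed by J
   and columns by I, of the relation M. *)
Definition relmap (M : I -> J -> bool) (phi : {ffun I -> R^o}) :
  {ffun J -> R^o} := [ffun j => \sum_(i | M i j) phi i].

Fact relmap_linear M : linear (relmap M).
Proof.
move=> a u v; apply/ffunP => j; rewrite !ffunE scaler_sumr -big_split /=.
by apply: eq_bigr => i _; rewrite !ffunE.
Qed.

HB.instance Definition _ M := GRing.isLinear.Build R
  {ffun I -> R^o} {ffun J -> R^o} _ (relmap M) (relmap_linear M).

End RelMap.

End RealFunctions.

Section Forms.

Variables (F : finFieldType) (V : vectType F).

Definition polar_form (Q : V -> F) (u v : V) : F := Q (u + v) - Q u - Q v.

Definition is_quadratic_form (Q : V -> F) : Prop :=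
  (forall a v, Q (a *: v) = a ^+ 2 * Q v) /\
  bilinear_for *%R *%R (polar_form Q).

(* The involution x |-> x ^ sqrt q of a field whose order q is a square. *)
Definition is_conjugation (theta : F -> F) : Prop :=
  exists2 q0 : nat, #|F| = (q0 ^ 2)%N & forall x, theta x = x ^+ q0.

(* Nondegeneracy is imposed separately, relative to a subspace. *)
Inductive classical_form : Type :=
| QuadraticForm (Q : V -> F) of is_quadratic_form Q
| HermitianForm (theta : involutive_rmorphism F)
    (h : {hermitian_sym V for theta}) of is_conjugation theta
| SymplecticForm (b : {skew_symmetric V}) of (forall v, b v v = 0).

End Forms.

(* Q+(2D-1,q), H(2D-1,q), W(2D-1,q), Q(2D,q), H(2D,q), Q-(2D+1,q) *)
Inductive polar_family : Type :=
| HyperbolicQuadric | HermitianOdd | SymplecticSpace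
| ParabolicQuadric | HermitianEven | EllipticQuadric.

Definition ambient_dim (t : polar_family) (D : nat) : nat :=
  match t with
  | HyperbolicQuadric | HermitianOdd | SymplecticSpace => D.*2
  | ParabolicQuadric | HermitianEven => D.*2.+1
  | EllipticQuadric => D.*2.+2
  end.

Definition polar_parameter (R : realType) (t : polar_family) : R :=
  match t with
  | HyperbolicQuadric => 0
  | HermitianOdd => 1 / 2
  | SymplecticSpace | ParabolicQuadric => 1
  | HermitianEven => 3 / 2
  | EllipticQuadric => 2
  end.

Section PolarSpaces.

Variables (F : finFieldType) (N : nat).
Local Notation V := 'rV[F]_N.

Definition form_in_family (f : classical_form V) (t : polar_family) : bool :=
  match f, t with
  | QuadraticForm _ _, (HyperbolicQuadric | ParabolicQuadric | EllipticQuadric)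
  | HermitianForm _ _ _, (HermitianOdd | HermitianEven)
  | SymplecticForm _ _, SymplecticSpace => true
  | _, _ => false
  end.

Definition totally_singular (f : classical_form V) (W : {vspace V}) : bool :=
  match f with
  | QuadraticForm Q _ => [forall v in W, Q v == 0]
  | HermitianForm _ h _ => [forall u in W, forall v in W, h u v == 0]
  | SymplecticForm b _ => [forall u in W, forall v in W, b u v == 0]
  end.

(* Nondegeneracy of the restriction of f to U.  For a quadratic form the radical
   of the polar form may be nonzero (parabolic quadrics, q even), but must not
   contain nonzero singular vectors. *)
Definition nondegenerate_on (f : classical_form V) (U : {vspace V}) : Prop :=
  match f with
  | QuadraticForm Q _ => forall v, v \in U -> Q v = 0 ->
      (forall u, u \in U -> polar_form Q u v = 0) -> v = 0
  | HermitianForm _ h _ => forall v, v \in U ->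
      (forall u, u \in U -> h u v = 0) -> v = 0
  | SymplecticForm b _ => forall v, v \in U ->
      (forall u, u \in U -> b u v = 0) -> v = 0
  end.

Definition witt_index (f : classical_form V) (U : {vspace V}) : nat :=
  \max_(W : {vspace V} | (W <= U)%VS && totally_singular f W) \dim W.

(* The subspaces of U that are totally singular for f form a classical polar
   space of family t and rank D.  The polar space cut out by a subspace A of U
   is that of f on A. *)
Definition classical_polar_space (f : classical_form V) (U : {vspace V})
    (t : polar_family) (D : nat) : Prop :=
  [/\ form_in_family f t, nondegenerate_on f U,
      \dim U = ambient_dim t D & witt_index f U = D].

(* Omega_a; the dimension is an integer so that Omega_(-1) is empty. *)
Definition Omega (f : classical_form V) (U : {vspace V}) (a : int) :
  {set {vspace V}} :=
  [set W | [&& (W <= U)%VS, totally_singular f W & (\dim W)%:Z == a]].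

Definition omega f U a : finType := {W : {vspace V} | W \in Omega f U a}.

Section Incidence.

Variables (R : realType) (f : classical_form V) (U : {vspace V}).

Definition charvec (a : int) (S : {set {vspace V}}) :
  {ffun omega f U a -> R^o} := [ffun W => (val W \in S)%:R].

Definition incident (W T : {vspace V}) : bool := (W <= T)%VS || (T <= W)%VS.

Definition incidence (a b : int) :
  'Hom({ffun omega f U a -> R^o}, {ffun omega f U b -> R^o}) :=
  linfun (relmap (fun (W : omega f U a) (T : omega f U b) =>
                      incident (val W) (val T))).

(* V^a_{r,i} in the polar space of rank D carried by U *)
Definition Vspace (D : nat) (a r i : int) :
  {vspace {ffun omega f U a -> R^o}} :=
  (limg (incidence r a) :&: orthocompl (limg (incidence (r - 1) a))
   :&: limg (incidence (D%:Z - i) a)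
   :&: orthocompl (limg (incidence (D%:Z - i + 1) a)))%VS.

Definition disjointness (D : nat) : 'End({ffun omega f U D -> R^o}) :=
  linfun (relmap (fun W T : omega f U D => (val W :&: val T == 0)%VS)).

Definition cameron_liebler (D : nat) (L : {set {vspace V}}) : Prop :=
  L \subset Omega f U D /\
  exists2 lambda : R,
    (Vspace D D 1 0 <= passmx.leigenspace (disjointness D) lambda)%VS &
    charvec D L \in (Vspace D D 0 0 + passmx.leigenspace (disjointness D) lambda)%VS.

Definition cl_parameter (t : polar_family) (D : nat) (L : {set {vspace V}}) : R :=
  #|L|%:R / \prod_(i < D.-1) (#|F|%:R `^ (polar_parameter R t + i%:R) + 1).

End Incidence.

(* (m, d-1)-ovoids of the polar space of rank d carried by U *)
Section Ovoids.

Variables (R : realType) (f : classical_form V) (U : {vspace V}) (d : nat).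

Definition ovoid (m : nat) (M : {set {vspace V}}) : Prop :=
  M \subset Omega f U (d%:Z - 1) /\
  forall G, G \in Omega f U d -> #|[set W in M | (W <= G)%VS]| = m.

Definition nontrivial (M : {set {vspace V}}) : Prop :=
  M <> set0 /\ M <> Omega f U (d%:Z - 1).

Definition regular (M : {set {vspace V}}) : Prop :=
  exists c1 c2 : nat, forall W, W \in Omega f U (d%:Z - 1) ->
    #|[set T in M | ((\dim (T :&: W))%:Z == d%:Z - 2) &&
                    ((T + W)%VS \notin Omega f U d)]|
    = (if W \in M then c1 else c2).

Definition regular_ovoid_of_type (m r : nat)
    (M : {set {vspace V}}) : Prop :=
  [/\ ovoid m M, nontrivial M, regular M &
      charvec R f U (d%:Z - 1) M \in
        (Vspace R f U d (d%:Z - 1) 0 0 + Vspace R f U d (d%:Z - 1) r 1)%VS].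

End Ovoids.

End PolarSpaces.

(* Main.v *)
Require Import Defs.
From mathcomp Require Import all_boot all_order all_algebra.
From mathcomp Require Import finfield zify ring.
From mathcomp Require Import reals exp.

Set Implicit Arguments.
Unset Strict Implicit.
Unset Printing Implicit Defensive.

Import Order.TTheory GRing.Theory Num.Theory.
Local Open Scope ring_scope.

(* For a generator G and a point p outside G the number c of generators through
   p that are disjoint from G does not depend on (p, G).  Hence K maps the
   characteristic vector of the pencil of p to c times that of its complement,
   and every function G |-> a + sum_(p in G) theta p on generators lies in
   V_0 + V, where V is the eigenspace of K for -c.

   Since M has type 1, its characteristic vector is W |-> a0 + sum_(p in W) psi p.
   A generator G of P meets alpha in dimension d - 1 or d.  In the second case
   sum_(p in G :&: alpha) psi p is a constant s0, because averaging over the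
   hyperplanes of G :&: alpha only involves m.  As the number of points of
   G :&: alpha tells the two cases apart, the characteristic vector of L is
   again of the above shape.  The parameter follows by counting the generators
   of P that meet alpha exactly in a given element of M. *)

(** * Forms *)

(* An affine line v + F p through a singular p not orthogonal to v carries kappa
   singular vectors: kappa is 1, sqrt q or q for a quadratic, Hermitian or
   symplectic form, and q ^ e = kappa * q ^ (dim U - 2 D). *)
Record polarity (F : finFieldType) (V : vectType F) (B : V -> V -> F)
    (sing : pred V) (kappa : nat) : Prop := Polarity {
  polarity_linear : forall a u w v, B (a *: u + w) v = a * B u v + B w v;
  polarity_sym : forall u v, (B u v == 0) = (B v u == 0);
  polarity_sing0 : sing 0;
  polarity_self : forall v, sing v -> B v v = 0;
  polarity_sing : forall a u v, sing u -> sing v -> B u v = 0 ->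
    sing (a *: u + v);
  polarity_gt0 : (0 < kappa)%N;
  polarity_line : forall p v, sing p -> B v p != 0 ->
    #|[pred a | sing (v + a *: p)]| = kappa }.

Definition form_bilin (F : finFieldType) (V : vectType F)
    (f : classical_form V) : V -> V -> F :=
  match f with
  | QuadraticForm Q _ => polar_form Q
  | HermitianForm _ h _ => h
  | SymplecticForm b _ => b
  end.

Definition form_sing (F : finFieldType) (V : vectType F)
    (f : classical_form V) : pred V :=
  match f with
  | QuadraticForm Q _ => [pred v | Q v == 0]
  | HermitianForm _ h _ => [pred v | h v v == 0]
  | SymplecticForm _ _ => predT
  end.

(** Along the line [v + a *: p] with [p] singular, [Q] takes the value [Q v + a * polar_form Q v p],
    which is affine in [a] with nonzero slope and so has exactly one zero. *)
Lemma quadratic_polarity (F : finFieldType) (V : vectType F) (Q : V -> F) :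
  is_quadratic_form Q -> polarity (polar_form Q) [pred v | Q v == 0] 1.
Proof.
case=> QZ BB; have Bl := BB.1.
have Q0 : Q 0 = 0 by rewrite -(scale0r 0) QZ expr0n mul0r.
have QD u v : Q (u + v) = Q u + Q v + polar_form Q u v.
  by rewrite /polar_form; ring.
have BC u v : polar_form Q u v = polar_form Q v u.
  by rewrite /polar_form (addrC u) addrAC.
have BZ a u v : polar_form Q (a *: u) v = a * polar_form Q u v.
  by have := Bl v a u 0; rewrite addr0 /= => ->; rewrite /polar_form add0r Q0; ring.
split=> //=.
- by move=> a u w v; rewrite (Bl v).
- by move=> u v; rewrite BC.
- by rewrite Q0.
- move=> v /eqP Qv; rewrite /polar_form -mulr2n -scaler_nat QZ Qv; ring.
- by move=> a u v /eqP Qu /eqP Qv Buv; rewrite QD QZ Qu Qv BZ Buv; apply/eqP; ring.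
- move=> p v /eqP Qp Bvp; rewrite -(card1 (- Q v / polar_form Q v p)).
  apply: eq_card => a; rewrite !inE QD QZ Qp BC BZ -(BC v) mulr0 addr0.
  by rewrite addrC addr_eq0 -(can2_eq (mulfK Bvp) (mulfVK Bvp)).
Qed.

Lemma symplectic_polarity (F : finFieldType) (V : vectType F)
    (b : {skew_symmetric V}) :
  (forall v, b v v = 0) -> polarity b predT #|F|.
Proof.
move=> bvv; split=> //.
- by move=> a u w v; rewrite linearPl.
- by move=> u v; rewrite herm_eq0C.
- exact: (ltnW (finNzRing_gt1 F)).
Qed.

(** * Hermitian forms and the fibres of the trace map *)

Section SquareField.
Variables (F : finFieldType) (q0 : nat) (theta : involutive_rmorphism F).
Hypotheses (cardF : #|F| = (q0 ^ 2)%N) (thetaE : forall x, theta x = x ^+ q0).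

Lemma conjugation_order_gt1 : (1 < q0)%N.
Proof. by have := finNzRing_gt1 F; rewrite cardF; case: q0 => [|[|]]. Qed.

(** A polynomial of degree [q0] has at most [q0] roots. With [c = 1] this bounds the fibres of the
    trace, with [c = -1] and [t = 0] the set of fixed points of [theta]. *)
Lemma card_trinomial_roots (c t : F) :
  (#|[pred x : F | x ^+ q0 + c * x == t]%R| <= q0)%N.
Proof.
have q1 := conjugation_order_gt1.
pose P : {poly F} := 'X^q0 + (c *: 'X - t%:P).
have szP : size P = q0.+1.
  rewrite size_polyDl size_polyXn // (leq_ltn_trans (size_polyD _ _)) //.
  rewrite size_polyN gtn_max (leq_ltn_trans (size_scale_leq _ _)) ?size_polyX //=.
  by rewrite (leq_ltn_trans (size_polyC_leq1 _)) // ltnS ltnW.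
have P0 : P != 0 by rewrite -size_poly_eq0 szP.
have := @max_poly_roots _ P (enum [pred x : F | x ^+ q0 + c * x == t]) P0.
rewrite -cardE szP ltnS; apply; last exact: enum_uniq.
apply/allP => x; rewrite mem_enum inE => /eqP xt.
by rewrite rootE !hornerD hornerXn hornerN hornerZ hornerX hornerC addrA xt subrr.
Qed.

(* The trace x |-> x + x^q0 maps F into the at most q0 roots of x^q0 = x, with
   fibres of size at most q0; as |F| = q0^2, all these bounds are equalities. *)
Lemma card_trace_fibre (t : F) : theta t = t ->
  #|[pred x : F | x + theta x == t]| = q0.
Proof.
move=> tt.
have thetaK x : theta (theta x) = x by exact: rmorphK.
have thetaD x y : theta (x + y) = theta x + theta y by exact: rmorphD.
pose K := [pred x : F | theta x == x].
pose fib (t : F) := [pred x : F | x + theta x == t].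
have fib_le x : (#|fib x| <= q0)%N.
  apply: leq_trans (card_trinomial_roots 1 x); apply: subset_leq_card.
  by apply/subsetP=> y; rewrite !inE thetaE mul1r addrC.
have K_le : (#|K| <= q0)%N.
  apply: leq_trans (card_trinomial_roots (-1) 0); apply: subset_leq_card.
  by apply/subsetP=> y; rewrite !inE thetaE mulN1r subr_eq0.
have sumK : (\sum_(x in K) #|fib x| = q0 ^ 2)%N.
  rewrite -cardF -sum1_card [RHS](partition_big (fun x => x + theta x) (mem K)) /=.
    by apply: eq_bigr => x _; rewrite -sum1_card; apply: eq_bigl => y; rewrite inE.
  by move=> x _; rewrite inE thetaD thetaK addrC.
apply/eqP; rewrite eqn_leq fib_le /= leqNgt; apply/negP => lt.
have q1 := conjugation_order_gt1.
suff : (\sum_(x in K) #|fib x| < q0 ^ 2)%N by rewrite sumK ltnn.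
have tK : t \in K by rewrite inE tt.
rewrite (bigD1 t) //=.
have le1 : (\sum_(i in K | i != t) #|fib i| <= #|K|.-1 * q0)%N.
  apply: (@leq_trans (\sum_(i in K | i != t) q0)); first by apply: leq_sum.
  rewrite sum_nat_const leq_mul2r; apply/orP; right.
  rewrite (cardD1 t K) tK /=; apply: subset_leq_card.
  by apply/subsetP => x; rewrite !inE andbC.
apply: (@leq_trans (q0 + #|K|.-1 * q0)); first by rewrite -addSn leq_add.
rewrite -mulSn prednK; first by rewrite -mulnn leq_mul2r K_le orbT.
by apply/card_gt0P; exists t.
Qed.

(** On the line [v + a *: p] the form is the trace of [a * h p v] plus [h v v]. Since [h p v != 0],
    the singular vectors on the line correspond to the trace fibre over [- h v v]. *)
Lemma hermitian_polarity (V : vectType F) (h : {hermitian_sym V for theta}) :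
  polarity h [pred v | h v v == 0] q0.
Proof.
have hC u v : h u v = theta (h v u) by rewrite hermC expr0 mul1r.
split=> /=.
- by move=> a u w v; rewrite linearPl.
- by move=> u v; rewrite herm_eq0C.
- by rewrite linear0l.
- by move=> v /eqP.
- move=> a u v /eqP hu /eqP hv huv.
  rewrite linearPl !linearPr /= hu hv (hC v) huv rmorph0; apply/eqP; ring.
- exact: ltnW conjugation_order_gt1.
- move=> p v /eqP hp hvp.
  have hpv : h p v != 0 by rewrite herm_eq0C.
  have thetaN x : theta (- x) = - theta x by exact: rmorphN.
  have thetaM x y : theta (x * y) = theta x * theta y by exact: rmorphM.
  rewrite -(@card_trace_fibre (- h v v)); last by rewrite thetaN -hC.
  have line a : h (v + a *: p) (v + a *: p) =
      a * h p v + theta (a * h p v) + h v v.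
    rewrite thetaM -hC !(linearDl, linearDr, linearZl_LR, linearZr_LR) /= hp.
    by rewrite !mulr0 addr0; ring.
  rewrite -(card_imset _ (mulIf hpv)); apply: eq_card => b.
  apply/imsetP/idP => [[a]|]; rewrite !inE.
    by rewrite line addr_eq0 => ? ->.
  by move=> e; exists (b / h p v); rewrite ?divfK // inE line divfK // addr_eq0.
Qed.

End SquareField.

(** * Counting subspaces *)

Section Counting.
Variables (F : finFieldType) (N : nat).
Local Notation V := 'rV[F]_N.
Local Notation q := #|F|.
Implicit Types (S G H U W : {vspace V}) (x p : V).

Lemma dim_add_line W x : x \notin W -> \dim (W + <[x]>) = (\dim W).+1.
Proof.
move=> xW; have xn0 : x != 0 by apply: contraNneq xW => ->; rewrite mem0v.
rewrite dimv_disjoint_sum ?dim_vline ?xn0 ?addn1 //.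
apply/eqP; rewrite -subv0; apply/subvP => y /memv_capP[yW /vlineP[a ya]].
rewrite memv0 ya; case: (eqVneq a 0) => [->|a0]; first by rewrite scale0r.
by move: xW; rewrite -(scalerK a0 x) -ya memvZ.
Qed.

Lemma card_vspaceD W S :
  #|[pred x in W | x \notin S]| = (q ^ \dim W - q ^ \dim (W :&: S))%N.
Proof.
rewrite -!card_vspace; have := cardID (mem S) (mem W).
have -> : #|[predI mem W & mem S]| = #|(W :&: S)%VS|.
  by apply: eq_card => x; rewrite !inE memv_cap.
by move<-; rewrite addKn; apply: eq_card => x; rewrite !inE andbC.
Qed.

(** Double count of the pairs [(H, x)] with [x] in [H] but not in [S]. It drives the inductions
    below, in which the members of [A] through [x] are those containing [S + <[x]>]. *)
Lemma card_flags (A : {set {vspace V}}) S n :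
  (forall H, H \in A -> (S <= H)%VS /\ \dim H = n) ->
  (#|A| * (q ^ n - q ^ \dim S) =
     \sum_(x : V | x \notin S) #|[set H in A | x \in H]|)%N.
Proof.
move=> hA.
transitivity (\sum_(H in A) \sum_(x : V | (x \notin S) && (x \in H)) 1)%N.
  rewrite -sum_nat_const; apply: eq_bigr => H /hA[SH <-].
  rewrite sum1_card; have := card_vspaceD H S; rewrite (capv_idPr SH) => <-.
  by apply: eq_card => x; rewrite !inE andbC.
rewrite (exchange_big_dep (fun x => x \notin S)) /=; last by move=> H x _ /andP[].
apply: eq_bigr => x xS; rewrite sum1_card; apply: eq_card => H.
by rewrite !inE xS.
Qed.

Lemma card_hyperplanes S W k : (S <= W)%VS -> (\dim S + k = \dim W)%N ->
  #|[set H | [&& S <= H, H <= W & (\dim H).+1 == \dim W]%VS]| =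
    (\sum_(i < k) q ^ i)%N.
Proof.
have q1 := finNzRing_gt1 F.
elim: k S => [|k IH] S SW dS.
  rewrite big_ord0; apply/eqP; rewrite cards_eq0 -subset0; apply/subsetP => H.
  rewrite !inE => /and3P[SH _ /eqP dH]; have := dimvS SH; lia.
set A := [set H | _].
have hA H : H \in A -> (S <= H)%VS /\ \dim H = (\dim S + k)%N.
  by rewrite inE => /and3P[-> _ /eqP]; lia.
(* In codimension 1 the only hyperplane is [S] itself and the flag count degenerates to [0 = 0], so
   this case is treated apart. *)
case: k IH dS hA => [|k] IH dS hA.
  rewrite big_ord_recl big_ord0 /= expn0 addn0 -[RHS](cards1 S).
  apply: eq_card => H; rewrite [RHS]inE; apply/idP/eqP => [/hA[SH dH]|->].
    by apply/esym/eqP; rewrite eqEdim SH; lia.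
  by rewrite inE subvv SW; apply/eqP; lia.
have := card_flags hA.
rewrite (bigID (fun x => x \in W)) /= [RHS]addnC big1 ?add0n => [|x /andP[_ xW]]; last first.
  apply/eqP; rewrite cards_eq0 -subset0; apply/subsetP => H.
  by rewrite !inE => /andP[/and3P[_ HW _]] /(subvP HW); rewrite (negPf xW).
rewrite (eq_bigr (fun _ => \sum_(i < k.+1) q ^ i)%N) => [|x /andP[xS xW]].
  rewrite sum_nat_const.
  have -> : #|[pred x : V | (x \notin S) && (x \in W)]| = (q ^ \dim W - q ^ \dim S)%N.
    have := card_vspaceD W S; rewrite (capv_idPr SW) => <-.
    by apply: eq_card => x; rewrite !inE andbC.
  have geo j : ((q - 1) * \sum_(i < j) q ^ i = q ^ j - 1)%N.
    by rewrite !subn1 predn_exp.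
  have fac j : (q ^ (\dim S + j) - q ^ \dim S = q ^ \dim S * (q ^ j - 1))%N.
    by rewrite expnD mulnBr muln1.
  rewrite -dS !fac -!geo => e.
  have c0 : (0 < q ^ \dim S * ((q - 1) * \sum_(i < k.+1) q ^ i))%N.
    by rewrite !muln_gt0 expn_gt0 subn_gt0 q1 (ltnW q1) big_ord_recl addn_gt0.
  by apply/eqP; rewrite -(eqn_pmul2r c0) e; apply/eqP; ring.
rewrite -(IH (S + <[x]>)%VS).
- apply: eq_card => H; rewrite !inE subv_add.
  by rewrite -memvE; case: (S <= H)%VS; case: (x \in H); rewrite ?andbT ?andbF.
- by rewrite subv_add SW -memvE.
- by rewrite dim_add_line //; lia.
Qed.

Lemma card_lines W :
  #|[set l | (l <= W)%VS && (\dim l == 1)%N]| = (\sum_(i < \dim W) q ^ i)%N.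
Proof.
have q1 := finNzRing_gt1 F.
set A := [set l | _].
have hA l : l \in A -> (0 <= l)%VS /\ \dim l = 1%N.
  by rewrite inE sub0v => /andP[_ /eqP].
have := card_flags hA; rewrite dimv0 expn0 expn1.
rewrite (bigID (fun x => x \in W)) /= [RHS]addnC big1 ?add0n => [|x /andP[_ xW]]; last first.
  apply/eqP; rewrite cards_eq0 -subset0; apply/subsetP => l.
  by rewrite !inE => /andP[/andP[/subvP pW _]] /pW; rewrite (negPf xW).
rewrite (eq_bigr (fun _ => 1%N)) => [|x /andP[x0 xW]].
  rewrite sum1_card.
  have -> : #|[pred x : V | (x \notin (0 : {vspace V})%VS) && (x \in W)]| = (q ^ \dim W - 1)%N.
    have := card_vspaceD W 0%VS; rewrite capv0 dimv0 expn0 => <-.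
    by apply: eq_card => x; rewrite !inE andbC.
  rewrite [in RHS]subn1 predn_exp => e.
  have c0 : (0 < q - 1)%N by rewrite subn_gt0.
  by apply/eqP; rewrite -(eqn_pmul2r c0) e -subn1 mulnC.
rewrite -[RHS](cards1 <[x]>%VS); apply: eq_card => l; rewrite !inE.
rewrite memv0 in x0.
apply/idP/eqP => [/andP[/andP[pW /eqP dp] xp]|->].
  by apply/esym/eqP; rewrite eqEdim -memvE xp dp dim_vline x0.
by rewrite dim_vline x0 memv_line -memvE xW.
Qed.

End Counting.

(** * Polar spaces *)

Section PolarGeometry.
Variables (F : finFieldType) (N : nat).
Local Notation V := 'rV[F]_N.
Local Notation q := #|F|.
Variables (B : V -> V -> F) (sing : pred V) (kappa : nat).
Hypothesis polB : polarity B sing kappa.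
Implicit Types (A S G H U W : {vspace V}) (x p v w : V).

(** * Orthogonal subspaces *)

Definition perp W : {vspace V} :=
  (\sum_(u | [forall w in W, B u w == 0%R]) <[u]>)%VS.

Lemma pol0l w : B 0 w = 0.
Proof. by have := polarity_linear polB (-1) 0 0 w; rewrite scaler0 addr0 mulN1r addNr. Qed.

Lemma polDl u v w : B (u + v) w = B u w + B v w.
Proof. by rewrite -[u in LHS]scale1r (polarity_linear polB) mul1r. Qed.

Lemma polZl a u w : B (a *: u) w = a * B u w.
Proof. by rewrite -[_ *: _]addr0 (polarity_linear polB) pol0l addr0. Qed.

(** The vectors orthogonal to [W] are closed under linear combinations because [B] is linear in its
    first argument, so the span taken in [perp] adds no vector. *)
Lemma mem_perp W u : reflect (forall w, w \in W -> B u w = 0) (u \in perp W).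
Proof.
apply: (iffP idP) => [|uW]; last first.
  rewrite memvE; apply: (sumv_sup u) => //; apply/forall_inP => w /uW ->.
  exact: eqxx.
case/memv_sumP => us us_in -> w wW.
elim/big_ind: _ => [|x y x0 y0|v vP]; first exact: pol0l.
  by rewrite polDl x0 y0 addr0.
have /vlineP[a ->] := us_in v vP.
by rewrite polZl (eqP (forall_inP vP w wW)) mulr0.
Qed.

Lemma Bsym0 u v : B u v = 0 -> B v u = 0.
Proof. by move/eqP; rewrite (polarity_sym polB) => /eqP. Qed.

Lemma perpC S W : (S <= perp W)%VS = (W <= perp S)%VS.
Proof.
apply/subvP/subvP => h u uS; apply/mem_perp => w wS; apply: Bsym0.
  by move/mem_perp: (h w wS); apply.
by move/mem_perp: (h w wS); apply.
Qed.

Lemma perpS S W : (S <= W)%VS -> (perp W <= perp S)%VS.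
Proof. by move=> SW; rewrite perpC; apply: subv_trans SW _; rewrite perpC. Qed.

Lemma perpD S W : perp (S + W) = (perp S :&: perp W)%VS.
Proof.
apply/eqP; rewrite eqEsubv subv_cap !perpS ?addvSl ?addvSr //=.
by rewrite perpC subv_add -perpC capvSl -perpC capvSr.
Qed.

Lemma mem_perp_line x u : (u \in perp <[x]>%VS) = (B u x == 0).
Proof.
apply/mem_perp/eqP => [|/Bsym0 ux w /vlineP[a ->]]; first by apply; apply: memv_line.
by apply: Bsym0; rewrite polZl ux mulr0.
Qed.

(** If some [y] in [A] is not orthogonal to [x], subtracting a suitable multiple of [y] moves any
    vector of [A] into [perp <[x]>]; hence one dimension at most is lost. *)
Lemma dim_cap_perp_line A x : (\dim A <= (\dim (A :&: perp <[x]>)).+1)%N.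
Proof.
have [sub|/subvPn[y yA]] := boolP (A <= perp <[x]>)%VS.
  by rewrite (capv_idPl sub).
rewrite mem_perp_line => yx.
rewrite (leq_trans _ (_ : \dim ((A :&: perp <[x]>) + <[y]>) <= _)%N) //.
  apply: dimvS; apply/subvP => z zA.
  rewrite -(subrK (B z x / B y x *: y) z) memv_add ?memvZ ?memv_line //.
  rewrite memv_cap memvB ?memvZ // mem_perp_line addrC -scaleNr (polarity_linear polB).
  by rewrite mulNr divfK // addNr eqxx.
by rewrite (leq_trans (dimv_add_leqif _ _)) // dim_vline; case: (_ != _); lia.
Qed.

Lemma dim_cap_perp A W : (\dim A <= \dim (A :&: perp W) + \dim W)%N.
Proof.
suff: (\dim A <= \dim (A :&: perp <<vbasis W>>) + size (vbasis W))%N.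
  by rewrite (span_basis (vbasisP W)) size_tuple.
elim: (tval (vbasis W)) => [|x X IH] /=.
  rewrite addn0 dimvS // subv_cap subvv perpC span_nil sub0v //.
rewrite span_cons perpD (capvC (perp _)) capvA.
by rewrite (leq_trans IH) // addnS -addSn leq_add2r dim_cap_perp_line.
Qed.

(** * Totally singular subspaces *)

Definition ts W := [forall u in W, sing u && [forall v in W, B u v == 0]].

Lemma tsP W : reflect ((forall u, u \in W -> sing u) /\ (W <= perp W)%VS) (ts W).
Proof.
apply: (iffP forall_inP) => [h|[h1 /subvP h2] u uW].
  split=> [u /h/andP[] //|]; apply/subvP => u /h/andP[_ /forall_inP uW].
  by apply/mem_perp => w /uW/eqP.
rewrite h1 //=; apply/forall_inP => w wW.
by have /mem_perp-> := h2 u uW.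
Qed.

Lemma ts_sing W u : ts W -> u \in W -> sing u.
Proof. by case/tsP => h _ /h. Qed.

Lemma ts_perp W : ts W -> (W <= perp W)%VS.
Proof. by case/tsP. Qed.

Lemma tsS S W : (S <= W)%VS -> ts W -> ts S.
Proof.
move=> SW /tsP[h1 h2]; apply/tsP; split=> [u /(subvP SW)/h1 //|].
exact: subv_trans SW (subv_trans h2 (perpS SW)).
Qed.

Lemma tsD S W : ts S -> ts W -> (W <= perp S)%VS -> ts (S + W).
Proof.
move=> /tsP[s1 p1] /tsP[s2 p2] WS; apply/tsP; split.
  move=> u /memv_addP[x xS [y yW ->]].
  rewrite -[x]scale1r; apply: (polarity_sing polB); [exact: s1|exact: s2|].
  by apply: Bsym0; apply: (mem_perp _ _ _ _ xS); apply: (subvP WS).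
by rewrite perpD subv_cap !subv_add p1 p2 WS perpC WS.
Qed.

Lemma ts_line x : sing x -> ts <[x]>.
Proof.
move=> sx; apply/tsP; split=> [u /vlineP[a ->]|].
  rewrite -[_ *: _]addr0; apply: (polarity_sing polB) => //.
    exact: (polarity_sing0 polB).
  by apply: Bsym0; rewrite pol0l.
by rewrite -memvE mem_perp_line (polarity_self polB).
Qed.

(** Nondegeneracy is stated for singular vectors, so that parabolic quadrics in even characteristic,
    whose polar form has a nonzero radical, are covered. *)
Record polar_space U (D : nat) : Prop := PolarSpace {
  polar_nondeg : forall v, v \in U -> sing v -> (U <= perp <[v]>)%VS -> v = 0;
  polar_rank_le : forall W, (W <= U)%VS -> ts W -> (\dim W <= D)%N;
  polar_rank_ex : exists2 W, (W <= U)%VS & ts W /\ \dim W = D }.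

Variables (U : {vspace V}) (D : nat).
Hypothesis psU : polar_space U D.

(* If U :&: S^perp were too large, a complement T of it in U would be smaller
   than S, so some nonzero vector of S would be orthogonal to T, hence to U. *)
Lemma dim_perp S : (S <= U)%VS -> ts S -> (\dim (U :&: perp S) + \dim S = \dim U)%N.
Proof.
move=> SU tsS0; apply/eqP; rewrite eqn_leq dim_cap_perp andbT leqNgt.
apply/negP => lt.
pose T := (U :\: (U :&: perp S))%VS.
have dT : (\dim (U :&: perp S) + \dim T = \dim U)%N.
  by rewrite -[RHS](dimv_cap_compl U (U :&: perp S)) capvA capvv.
have lt2 : (0 < \dim (S :&: perp T))%N.
  by have := dim_cap_perp S T; lia.
have [v] : exists2 v, v \in (S :&: perp T)%VS & v != 0.
  exists (vpick (S :&: perp T)); rewrite ?memv_pick // vpick0 -dimv_eq0; lia.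
case/memv_capP => vS /mem_perp vT /eqP[]; apply: (polar_nondeg psU).
- exact: (subvP SU).
- exact: ts_sing vS.
rewrite perpC -memvE; apply/mem_perp => w wU.
move: wU; rewrite -(addv_diff_cap U (U :&: perp S)) => /memv_addP[x xT [y yS ->]].
apply: Bsym0; rewrite polDl (Bsym0 (vT _ xT)) add0r.
by move: yS; rewrite capvA capvv => /memv_capP[_ /mem_perp ->].
Qed.

(** * Generators *)

Definition gens := [set G : {vspace V} | [&& (G <= U)%VS, ts G & \dim G == D]].

Lemma gensP G : reflect [/\ (G <= U)%VS, ts G & \dim G = D] (G \in gens).
Proof. by rewrite inE; apply: (iffP and3P) => -[? ? /eqP]. Qed.

Lemma ts_extend S : (S <= U)%VS -> ts S -> exists2 G, G \in gens & (S <= G)%VS.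
Proof.
move=> SU tS; have [G GU [tG dG]] := polar_rank_ex psU.
exists (S + (G :&: perp S))%VS; last exact: addvSl.
have le : (S + (G :&: perp S) <= U)%VS.
  by rewrite subv_add SU (subv_trans (capvSl _ _) GU).
have tsum : ts (S + (G :&: perp S)).
  by rewrite tsD ?capvSr // (tsS (capvSl _ _) tG).
apply/gensP; split=> //; apply/eqP; rewrite eqn_leq (polar_rank_le psU) //=.
(* As [G] is orthogonal to [S :&: G], only the complement [C] of [S :&: G] in [S] imposes conditions
   on [G]. So [G :&: perp S] has dimension at least [D - \dim C], and its sum with [S] has dimension
   at least [D]. *)
pose C := (S :\: G)%VS.
have sub : (G :&: perp C <= G :&: perp S)%VS.
  rewrite subv_cap capvSl -(addv_diff_cap S G) perpD subv_cap capvSr.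
  apply: subv_trans (capvSl _ _) (subv_trans (ts_perp tG) (perpS (capvSr _ _))).
have d1 := dim_cap_perp G C.
have d2 := dimv_cap_compl S G.
have d3 := dimv_sum_cap S (G :&: perp S).
have d4 := dimvS sub.
have d5 : (\dim (S :&: (G :&: perp S)) <= \dim (S :&: G))%N.
  by apply: dimvS; rewrite capvA capvSl.
rewrite -/C in d2; lia.
Qed.

(** If [x] were orthogonal to all of [G], then [G + <[x]>] would be totally singular of dimension
    [D + 1]. *)
Lemma gen_perp_cap G x : G \in gens -> x \in U -> sing x -> x \notin G ->
  (\dim (G :&: perp <[x]>)).+1 = D.
Proof.
case/gensP => GU tG dG xU sx xG; apply/eqP; rewrite eqn_leq -{2}dG dim_cap_perp_line.
rewrite andbT -dG ltnNge; apply/negP => le.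
have /capv_idPl : (G :&: perp <[x]> = G)%VS.
  by apply/eqP; rewrite eqEdim capvSl.
rewrite perpC => sub.
have := polar_rank_le psU (_ : G + <[x]> <= U)%VS (tsD tG (ts_line sx) sub).
by rewrite subv_add GU -memvE xU dim_add_line // dG ltnn => /(_ isT).
Qed.

Lemma gen_through G x : G \in gens -> x \in U -> sing x -> x \notin G ->
  (G :&: perp <[x]> + <[x]>)%VS \in gens.
Proof.
move=> Gg xU sx xG; have d := gen_perp_cap Gg xU sx xG.
case/gensP: (Gg) => GU tG dG; apply/gensP; split.
- by rewrite subv_add (subv_trans (capvSl _ _) GU) -memvE.
- apply: tsD; [exact: (tsS (capvSl _ _) tG)|exact: ts_line|].
  by rewrite perpC capvSr.
- by rewrite dim_add_line // memv_cap (negPf xG).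
Qed.

(** * Counting singular vectors and generators *)

Lemma card_secant W p : sing p -> p \in W -> ~~ (W <= perp <[p]>)%VS ->
  (#|[pred x in W | sing x && (B x p != 0%R)]| * q =
     (q ^ \dim W - q ^ (\dim W).-1) * kappa)%N.
Proof.
move=> sp pW Wp.
have Bshift v a : B (v + a *: p) p = B v p.
  by rewrite polDl polZl (polarity_self polB) // mulr0 addr0.
have dW : \dim (W :&: perp <[p]>) = (\dim W).-1.
  have lt : (\dim (W :&: perp <[p]>) < \dim W)%N.
    rewrite ltnNge; apply: contra Wp => le; apply/capv_idPl/eqP.
    by rewrite eqEdim capvSl.
  by have := dim_cap_perp_line W p; lia.
(* Both sides count the pairs [(v, a)] with [v] in [W] not orthogonal to [p] and [v + a *: p]
   singular. For fixed [v] there are [kappa] of them; for fixed [a], the shift by [a *: p] permutes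
   [W] and preserves [B _ p]. *)
transitivity (\sum_(v | (v \in W) && (B v p != 0%R)) \sum_(a | sing (v + a *: p)%R) 1)%N.
  rewrite (exchange_big_dep predT) //= mulnC -sum_nat_const.
  apply: eq_big => // a _.
  rewrite -sum1_card (reindex_inj (addIr (a *: p))) /=; apply: eq_bigl => v.
  by rewrite !inE Bshift (rpredDr _ (memvZ _ pW)) andbA andbAC.
rewrite (eq_bigr (fun _ => kappa)) => [|v /andP[_ vp]]; last first.
  by rewrite sum1_card; apply: (polarity_line polB).
rewrite sum_nat_const; congr (_ * _)%N.
rewrite -{1}dW -card_vspaceD.
by apply: eq_card => x; rewrite !inE mem_perp_line.
Qed.

(** This is [q ^ e] as a natural number: a totally singular subspace of dimension [D - 1] lies in
    [polar_order + 1] generators, by [card_gens_over] with [k = 1]. *)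
Definition polar_order : nat := (kappa * q ^ (\dim U - D.*2))%N.

(** A generator lies in its own perp, which meets [U] in dimension [\dim U - D]. Hence the
    subtraction in [polar_order] is never truncated. *)
Lemma rank_dim_le : (D.*2 <= \dim U)%N.
Proof.
have [G GU [tG dG]] := polar_rank_ex psU.
have := dim_perp GU tG.
have : (\dim G <= \dim (U :&: perp G))%N by rewrite dimvS // subv_cap GU ts_perp.
by lia.
Qed.

(* Double count of the pairs (x, p) with p in G \ S and x not orthogonal to p. *)
Lemma card_sing_perp_notin S G k :
  G \in gens -> (S <= G)%VS -> (\dim S + k = D)%N ->
  #|[pred x in U | [&& sing x, x \in perp S & x \notin G]]| =
    ((q ^ k - 1) * (polar_order * q ^ D.-1))%N.
Proof.
move=> Gg SG dS; have q1 := finNzRing_gt1 F.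
have [GU tG dG] := gensP _ Gg; have Du := rank_dim_le.
have SU := subv_trans SG GU; have tS := tsS SG tG.
case: k dS => [|k] dS.
  have eSG : S = G by apply/eqP; rewrite eqEdim SG; lia.
  rewrite expn0 subnn mul0n; apply: eq_card0 => x; rewrite !inE eSG.
  apply/negP => /and4P[xU sx xG] /negP; apply.
  have := gen_perp_cap Gg xU sx; case: (x \in G) => // /(_ isT).
  have : (G <= perp <[x]>)%VS by rewrite perpC -memvE.
  by move/capv_idPl ->; lia.
set P := [pred x in U | _].
pose X := (U :&: perp S)%VS.
have dX : (\dim X + \dim S = \dim U)%N by exact: dim_perp.
have secant p : p \in G -> p \notin S ->
  (#|[pred x in X | sing x && (B x p != 0%R)]| * q =
     (q ^ \dim X - q ^ (\dim X).-1) * kappa)%N.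
  move=> pG pS; apply: card_secant; first exact: ts_sing pG.
    rewrite memv_cap (subvP GU) //=.
    by apply: (subvP _ _ pG); rewrite perpC (subv_trans SG) // ts_perp.
  (* Otherwise [S] and the larger space [S + <[p]>] would have the same perp in [U], contradicting
     [dim_perp]. *)
  apply/negP => le.
  have := @dim_perp (S + <[p]>)%VS.
  have le' : (S + <[p]> <= G)%VS by rewrite subv_add SG -memvE.
  rewrite (subv_trans le') // (tsS le') // perpD capvA => /(_ isT isT).
  by rewrite -/X (capv_idPl le) dim_add_line //; lia.
have : (\sum_(p | (p \in G) && (p \notin S))
         \sum_(x in X | sing x && (B x p != 0%R)) 1 =
       #|P| * (q ^ D - q ^ D.-1))%N.
  rewrite (exchange_big_dep (mem P)) /=; last first.
    move=> p x /andP[pG _] /andP[/memv_capP[xU xS] /andP[sx xp]].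
    rewrite !inE xU sx xS; apply: contraNN xp => xG; apply/eqP.
    by have /mem_perp-> := subvP (ts_perp tG) _ xG.
  rewrite -sum_nat_const; apply: eq_bigr => x; rewrite !inE => /and4P[xU sx xS xG].
  have := gen_perp_cap Gg xU sx xG => dGx.
  rewrite sum1_card -{1}dG -[in RHS]dGx /= -card_vspaceD.
  apply: eq_card => p; rewrite !inE mem_perp_line memv_cap xU xS sx /=.
  rewrite (polarity_sym polB p x).
  rewrite unfold_in /=; have [_|xp] := eqVneq (B x p) 0; first by rewrite !andbF.
  rewrite !andbT andb_idr // => _; apply/negP => pS.
  by case/eqP: xp; apply: (elimT (mem_perp S x) xS).
move/(congr1 (muln^~ q)); rewrite big_distrl /=.
rewrite (eq_bigr (fun _ => (q ^ \dim X - q ^ (\dim X).-1) * kappa)%N); last first.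
  by move=> p /andP[pG pS]; rewrite sum1_card -(secant p).
rewrite sum_nat_const.
have -> : #|[pred p : V | (p \in G) && (p \notin S)]| = (q ^ D - q ^ \dim S)%N.
  by rewrite -{1}dG; have := card_vspaceD G S; rewrite (capv_idPr SG).
rewrite /polar_order.
set u := (\dim U - D.*2)%N.
have -> : \dim X = (u + \dim S + k + k.+1).+1 by rewrite /u; lia.
have fac j : (q ^ j.+1 - q ^ j = (q - 1) * q ^ j)%N.
  by rewrite expnS mulnBl mul1n.
have fac2 i j : (q ^ (i + j) - q ^ i = q ^ i * (q ^ j - 1))%N.
  by rewrite expnD mulnBr muln1.
rewrite -dS fac2 (addnS (\dim S)) /= !fac.
move: (q ^ k.+1 - 1)%N => Y e.
have c0 : (0 < (q - 1) * (q * q ^ (\dim S + k)))%N.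
  by rewrite !muln_gt0 !expn_gt0 subn_gt0 q1 (ltnW q1).
apply/eqP; rewrite -(eqn_pmul2r c0); apply/eqP.
transitivity (#|P| * ((q - 1) * q ^ (\dim S + k)) * q)%N; first by ring.
by rewrite -e !expnD !expnS; ring.
Qed.

Lemma gen_sing_perp S H x : H \in gens -> (S <= H)%VS -> x \in H ->
  [/\ x \in U, sing x & x \in perp S].
Proof.
case/gensP=> HU tH _ SH xH; split; [exact: (subvP HU)|exact: ts_sing xH|].
exact: subvP (subv_trans (ts_perp tH) (perpS SH)) _ xH.
Qed.

Lemma ts_add_line S x : (S <= U)%VS -> ts S -> x \in U -> sing x ->
  x \in perp S -> (S + <[x]> <= U)%VS /\ ts (S + <[x]>)%VS.
Proof.
move=> SU tS xU sx xS; rewrite subv_add SU -memvE xU; split=> //.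
by apply: tsD => //; apply: ts_line.
Qed.

Lemma pow_subn_gt0 a k : (0 < q ^ (a + k.+1) - q ^ a)%N.
Proof. by rewrite subn_gt0 ltn_exp2l ?finNzRing_gt1 // -[X in (X < _)%N]addn0 ltn_add2l. Qed.

Lemma pow_subn a k : (q ^ (a + k) - q ^ a = q ^ a * (q ^ k - 1))%N.
Proof. by rewrite expnD mulnBr muln1. Qed.

Definition gens_over S := [set H in gens | (S <= H)%VS].

Lemma mem_gens_over S H : (H \in gens_over S) = (H \in gens) && (S <= H)%VS.
Proof. exact: in_set. Qed.

(** Induction on [k]: the flag count passes from [S] to [S + <[x]>], where [x] runs over the
    singular vectors of [U] in [perp S] outside [S]. A generator [G] through [S] splits these into
    [G] minus [S] and the set counted in [card_sing_perp_notin]. *)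
Lemma card_gens_over S k : (S <= U)%VS -> ts S -> (\dim S + k = D)%N ->
  #|gens_over S| = (\prod_(i < k) (polar_order * q ^ i + 1))%N.
Proof.
elim: k S => [|k IH] S SU tS dS.
  rewrite big_ord0 -[RHS](cards1 S); apply: eq_card => H; rewrite !inE.
  apply/idP/eqP => [/andP[/and3P[_ _ /eqP dH] SH]|->].
    by apply/esym/eqP; rewrite eqEdim SH; lia.
  by rewrite SU tS subvv -dS addn0 eqxx.
have hA H : H \in gens_over S -> (S <= H)%VS /\ \dim H = D.
  by rewrite inE => /andP[/gensP[_ _ ->] ->].
have [G Gg SG] := ts_extend SU tS.
pose C := [pred x | [&& x \in U, sing x & x \in perp S]].
have card_C : #|[pred x | (x \notin S) && C x]| =
    (q ^ D - q ^ \dim S + (q ^ k.+1 - 1) * (polar_order * q ^ D.-1))%N.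
  rewrite -(cardID (mem G)) -(card_sing_perp_notin Gg SG dS); congr (_ + _)%N.
    have [_ _ <-] := gensP _ Gg; have := card_vspaceD G S.
    rewrite (capv_idPr SG) => <-; apply: eq_card => x; rewrite !inE.
    case xG: (x \in G); rewrite ?andbF // andbT.
    by have [-> -> ->] := gen_sing_perp Gg SG xG; rewrite !andbT.
  apply: eq_card => x; rewrite !inE.
  case: (boolP (x \in G)) => [|xG]; rewrite ?andbF // (contra (subvP SG x) xG).
  by rewrite !andbT.
have := card_flags hA; rewrite (bigID C) /= [RHS]addnC big1 ?add0n; last first.
  move=> x /andP[xS]; apply: contraNeq; rewrite cards_eq0 => /set0Pn[H].
  rewrite inE => /andP[]; rewrite inE => /andP[Hg SH] xH.
  by have [-> -> ->] := gen_sing_perp Hg SH xH.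
rewrite (eq_bigr (fun _ => \prod_(i < k) (polar_order * q ^ i + 1))%N); last first.
  move=> x /andP[xS /and3P[xU sx xpS]].
  have [leU tSx] := ts_add_line SU tS xU sx xpS.
  rewrite -(IH (S + <[x]>)%VS) ?dim_add_line //; last by lia.
  by apply: eq_card => H; rewrite !inE subv_add -memvE -!andbA.
rewrite sum_nat_const card_C -dS pow_subn (addnS (\dim S)) /= big_ord_recr /=.
rewrite expnD => e.
have := pow_subn_gt0 (\dim S) k; rewrite pow_subn => c0.
by apply/eqP; rewrite -(eqn_pmul2r c0) e; apply/eqP; ring.
Qed.

(* For x outside G, the generators through x meeting G in S correspond to those
   meeting the generator spanned by x and G :&: x^perp in S + <x>. *)
Lemma meet_gen_through S G H x : G \in gens -> H \in gens ->
  x \in U -> sing x -> x \notin G -> (S <= G)%VS -> x \in perp S ->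
  (x \in H) && (H :&: G == S)%VS =
  (H :&: (G :&: perp <[x]> + <[x]>) == S + <[x]>)%VS.
Proof.
move=> Gg Hg xU sx xG SG xS.
have [_ tH _] := gensP _ Hg.
apply/andP/eqP => [[xH /eqP HG]|e].
  have SH : (S <= H)%VS by rewrite -HG capvSl.
  apply/eqP; rewrite eqEsubv; apply/andP; split; last first.
    rewrite subv_cap subv_add SH -!memvE xH /= subv_add (subv_trans _ (addvSl _ _)).
      by rewrite -memvE (subvP (addvSr _ _)) ?memv_line.
    by rewrite subv_cap SG perpC -memvE.
  apply/subvP => z /memv_capP[zH /memv_addP[g /memv_capP[gG _] [w /vlineP[a ->] zE]]].
  rewrite zE memv_add ?memvZ ?memv_line // -HG memv_cap gG andbT.
  by rewrite -(addrK (a *: x) g) -zE memvB ?memvZ.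
have SxH : (S + <[x]> <= H)%VS by rewrite -e capvSl.
have xH : x \in H by rewrite memvE (subv_trans (addvSr _ _) SxH).
split=> //; rewrite eqEsubv subv_cap SG (subv_trans (addvSl _ _) SxH) !andbT.
apply/subvP => y /memv_capP[yH yG].
have : y \in (S + <[x]>)%VS.
  have /mem_perp yH0 := subvP (ts_perp tH) _ yH.
  rewrite -e memv_cap yH; apply: (subvP (addvSl _ _)).
  by rewrite memv_cap yG mem_perp_line yH0 ?eqxx.
case/memv_addP => z zS [w /vlineP[a ->] yE]; rewrite yE.
have [->|a0] := eqVneq a 0; first by rewrite scale0r addr0.
case/negP: xG; rewrite -(scalerK a0 x); apply: memvZ; rewrite -(addKr z (a *: x)) -yE.
by rewrite memvD // memvN (subvP SG).
Qed.

(** The same flag count with [x] outside [G]: by [meet_gen_through], the pair [(S, G)] is traded for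
    [S + <[x]>] and the generator spanned by [x] and [G :&: perp <[x]>]. *)
Lemma card_gens_meet S G k : G \in gens -> (S <= G)%VS -> (\dim S + k = D)%N ->
  #|[set H in gens | (H :&: G == S)%VS]| = (\prod_(i < k) (polar_order * q ^ i))%N.
Proof.
elim: k S G => [|k IH] S G Gg SG dS.
  have [GU tG dG] := gensP _ Gg.
  have <- : S = G by apply/eqP; rewrite eqEdim SG; lia.
  have Sg : S \in gens by have <- : G = S by apply/eqP; rewrite eq_sym eqEdim SG; lia.
  rewrite big_ord0 -[RHS](cards1 S); apply: eq_card => H; rewrite !inE.
  apply/andP/eqP => [[/and3P[_ _ /eqP dH] /eqP HS]|->].
    by apply/esym/eqP; rewrite eqEdim -{1}HS capvSl; lia.
  by rewrite capvv eqxx; move: Sg; rewrite inE.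
set A := [set H in gens | _].
have hA H : H \in A -> (S <= H)%VS /\ \dim H = D.
  by rewrite inE => /andP[/gensP[_ _ ->] /eqP <-]; rewrite capvSl.
have [GU tG dG] := gensP _ Gg; have SU := subv_trans SG GU; have tS := tsS SG tG.
pose C := [pred x in U | [&& sing x, x \in perp S & x \notin G]].
have := card_flags hA; rewrite (bigID C) /= [RHS]addnC big1 ?add0n; last first.
  move=> x /andP[xS]; apply: contraNeq; rewrite cards_eq0 => /set0Pn[H].
  rewrite inE => /andP[]; rewrite inE => /andP[Hg /eqP HG] xH.
  have SH : (S <= H)%VS by rewrite -HG capvSl.
  have [-> -> ->] := gen_sing_perp Hg SH xH; apply: contraNN xS => xG.
  by rewrite -HG memv_cap xH.
rewrite (eq_bigr (fun _ => \prod_(i < k) (polar_order * q ^ i))%N); last first.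
  move=> x /andP[xS /and4P[xU sx xpS xG]].
  have Gx := gen_through Gg xU sx xG.
  rewrite -(IH (S + <[x]>)%VS _ Gx) ?dim_add_line //; last by lia.
    apply: eq_card => H; rewrite [LHS]inE [X in X && _]inE [RHS]inE.
    case Hg: (H \in gens) => //=.
    by rewrite -(meet_gen_through Gg Hg xU sx xG SG xpS) andbC.
  by rewrite subv_add addvSr andbT (subv_trans _ (addvSl _ _)) // subv_cap SG perpC -memvE.
rewrite sum_nat_const.
have -> : #|[pred x : V | (x \notin S) && C x]| = ((q ^ k.+1 - 1) * (polar_order * q ^ D.-1))%N.
  rewrite -(card_sing_perp_notin Gg SG dS); apply: eq_card => x; rewrite !inE andb_idl //.
  by case/and4P=> _ _ _; apply: contra; apply: (subvP SG).
rewrite -dS pow_subn (addnS (\dim S)) /= big_ord_recr /= expnD => e.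
have := pow_subn_gt0 (\dim S) k; rewrite pow_subn => c0.
by apply/eqP; rewrite -(eqn_pmul2r c0) e; apply/eqP; ring.
Qed.
End PolarGeometry.

(** * Classical polar spaces *)

Section ClassicalForms.
Variables (F : finFieldType) (N : nat).
Local Notation V := 'rV[F]_N.
Local Notation q := #|F|.
Implicit Types (f : classical_form V) (U W : {vspace V}).

(** The value 1, sqrt q or q of [kappa] and the excess 0, 1 or 2 of the ambient dimension over [2 D]
    combine to [q ^ e] in each of the six families. *)
Lemma form_polarity f : exists2 kappa : nat,
  polarity (form_bilin f) (form_sing f) kappa &
  forall (R : realType) t D, form_in_family f t ->
    q%:R `^ polar_parameter R t = (kappa * q ^ (ambient_dim t D - D.*2))%:R.
Proof.
have qR (R : realType) : 0 <= q%:R :> R by [].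
have q0 (R : realType) : q%:R != 0 :> R by rewrite pnatr_eq0 -lt0n (ltnW (finNzRing_gt1 F)).
have sub1 D : (D.*2.+1 - D.*2 = 1)%N by lia.
have sub2 D : (D.*2.+2 - D.*2 = 2)%N by lia.
case: f => [Q Qq|theta h [q1 cardF thetaE]|b bvv].
- exists 1%N; first exact: quadratic_polarity.
  move=> R [] D //= _; rewrite ?subnn ?sub1 ?sub2 mul1n.
  + by rewrite powRr0.
  + by rewrite powRr1.
  + by rewrite (powR_mulrn 2) // natrX.
- exists q1; first exact: hermitian_polarity.
  have sq (R : realType) : q%:R `^ (1 / 2) = q1%:R :> R.
    rewrite cardF natrX -powR_mulrn // -powRrM.
    have -> : 2%:R * (1 / 2) = 1 :> R by field.
    by rewrite powRr1.
  move=> R [] D //= _; rewrite ?subnn ?sub1 ?muln1 ?expn1 //.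
  have -> : 3 / 2 = 1 / 2 + 1 :> R by field.
  by rewrite powRD ?q0 ?implybT // sq powRr1 // natrM.
- exists q; first exact: symplectic_polarity.
  by move=> R [] D //= _; rewrite subnn muln1 powRr1.
Qed.

Lemma totally_singularE f W :
  totally_singular f W = ts (form_bilin f) (form_sing f) W.
Proof.
case: f => [Q Qq|theta h hc|b bvv] /=.
- apply/forall_inP/forall_inP => h u uW; last by have /andP[] := h u uW.
  rewrite /= h //=; apply/forall_inP => v vW.
  have Q0 w : w \in W -> Q w = 0 by move=> /h/eqP.
  by rewrite /polar_form !Q0 ?memvD // !subr0.
- apply/forall_inP/forall_inP => h1 u uW; last by have /andP[] := h1 u uW.
  by rewrite /= h1 // (forall_inP (h1 u uW)).
- by apply/forall_inP/forall_inP => h1 u uW; have := h1 u uW.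
Qed.

Lemma classical_polar f U t D kappa :
  polarity (form_bilin f) (form_sing f) kappa ->
  classical_polar_space f U t D ->
  polar_space (form_bilin f) (form_sing f) U D.
Proof.
move=> pol [_ nd _ wi]; split.
- move=> v vU sv /subvP perpU.
  have {}perpU u : u \in U -> form_bilin f u v = 0.
    by move/perpU => /(mem_perp pol); apply; apply: memv_line.
  by case: f pol nd {wi} sv perpU => [Q Qq|theta h hc|b bvv] pol /= nd;
    [move=> /eqP sv|move=> _|move=> _] => perpU; apply: nd.
- move=> W WU tW; rewrite -wi; apply: leq_bigmax_cond.
  by rewrite WU totally_singularE.
- have [|W /andP[WU tW] dW] := @eq_bigmax_cond _
    [pred W : {vspace V} | (W <= U)%VS && totally_singular f W] (fun W => \dim W).
    (* The zero subspace shows that the maximum defining [witt_index] ranges over a nonempty set, so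
       it is attained. *)
    apply/card_gt0P; exists 0%VS; rewrite inE sub0v totally_singularE.
    apply/(tsP pol); split; last exact: sub0v.
    by move=> u; rewrite memv0 => /eqP ->; apply: (polarity_sing0 pol).
  by exists W => //; rewrite -totally_singularE tW -dW.
Qed.

Lemma OmegaE f U k : Omega f U (Posz k) = gens (form_bilin f) (form_sing f) U k.
Proof. by apply/setP => W; rewrite !inE totally_singularE. Qed.

End ClassicalForms.

(** * Incidence maps and the disjointness matrix *)

Section IncidenceMaps.
Variables (R : realType) (F : finFieldType) (N : nat).
Local Notation V := 'rV[F]_N.
Local Notation q := #|F|.
Variables (f : classical_form V) (U : {vspace V}).
Implicit Types (W T : {vspace V}) (a b : int).

Lemma sum_omega a (P : pred {vspace V}) (g : {vspace V} -> R) :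
  \sum_(W : omega f U a | P (val W)) g (val W) =
  \sum_(W in Omega f U a | P W) g W.
Proof. by rewrite big_sub_cond. Qed.

Lemma incidenceE a b (phi : {ffun omega f U a -> R^o}) (T : omega f U b) :
  incidence R f U a b phi T = \sum_(W | incident (val W) (val T)) phi W.
Proof. by rewrite lfunE ffunE. Qed.

(** Extension by 0 outside [Omega f U a], which lets sums over the subtype be handled as sums over
    subspaces. *)
Definition extend_omega a (phi : {ffun omega f U a -> R^o}) (W : {vspace V}) : R :=
  oapp phi 0 (insub W).

Lemma incidence_extend a b (phi : {ffun omega f U a -> R^o}) (T : omega f U b) :
  incidence R f U a b phi T =
  \sum_(W in Omega f U a | incident W (val T)) extend_omega phi W.
Proof.
rewrite incidenceE -(sum_omega _ (fun W => incident W (val T))).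
by apply: eq_bigr => W _; rewrite /extend_omega valK.
Qed.

Lemma incidence_const a b (c : R) (T : omega f U b) :
  incidence R f U a b [ffun=> c] T =
  c *+ #|[set W in Omega f U a | incident W (val T)]|.
Proof.
rewrite incidenceE (eq_bigr (fun=> c)) => [|W _]; last by rewrite ffunE.
rewrite (sum_omega _ (fun W => incident W (val T)) (fun=> c)) sumr_const.
by congr (_ *+ _); apply: eq_card => W; rewrite inE.
Qed.

Lemma Omega0 : Omega f U 0 = [set 0%VS].
Proof.
apply/setP => W; rewrite !inE; apply/and3P/eqP => [[_ _]|->].
  by rewrite eqz_nat dimv_eq0 => /eqP.
rewrite sub0v dimv0; split=> //; rewrite totally_singularE.
have [kappa pol _] := form_polarity f; apply/(tsP pol); split; last exact: sub0v.
by move=> u; rewrite memv0 => /eqP ->; apply: (polarity_sing0 pol).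
Qed.

Lemma mem_Omega0 W : (W \in Omega f U 0) = (W == 0%VS).
Proof. by rewrite Omega0 in_set1. Qed.

Lemma incidence_from0 b (phi : {ffun omega f U 0 -> R^o}) :
  incidence R f U 0 b phi = [ffun=> extend_omega phi 0%VS].
Proof.
apply/ffunP => T; rewrite incidence_extend ffunE (big_pred1 0%VS) // => W.
by rewrite Omega0 inE /=; case: eqP => [->|//]; rewrite /incident sub0v.
Qed.

Lemma incident_same_dim W T : \dim W = \dim T -> incident W T = (W == T).
Proof.
move=> dWT; apply/orP/eqP => [[WT|TW]|->]; last by left.
  by apply/eqP; rewrite eqEdim WT dWT leqnn.
by apply/esym/eqP; rewrite eqEdim TW dWT leqnn.
Qed.

Lemma mem_orthocompl (I : finType) (A : {vspace {ffun I -> R^o}}) u :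
  reflect (forall v, v \in A -> ffdot u v = 0) (u \in orthocompl A).
Proof. exact: mem_orthovP. Qed.

Lemma incidence_empty a b phi : (forall W, W \notin Omega f U a) -> incidence R f U a b phi = 0.
Proof.
move=> e; apply/ffunP => T; rewrite incidenceE ffunE big1 // => W _.
by case/negP: (e (val W)); apply: (valP W).
Qed.

Lemma ffdot0r (I : finType) (u : {ffun I -> R^o}) : ffdot u 0 = 0.
Proof. by rewrite /ffdot big1 // => i _; rewrite ffunE mulr0. Qed.

Lemma mem_leigenspace (I : finType) (K : 'End({ffun I -> R^o})) lambda phi :
  reflect (forall i, K phi i = lambda * phi i) (phi \in passmx.leigenspace K lambda).
Proof.
rewrite memv_ker add_lfunE opp_lfunE scale_lfunE id_lfunE subr_eq0.
apply: (iffP eqP) => [-> i|h]; first by rewrite ffunE.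
by apply/ffunP => i; rewrite h ffunE.
Qed.

End IncidenceMaps.

(** * The disjointness matrix and its eigenspace containing [V_1] *)

Section Disjointness.
Variables (R : realType) (F : finFieldType) (N : nat).
Local Notation V := 'rV[F]_N.
Local Notation q := #|F|.
Variables (f : classical_form V) (U : {vspace V}) (D kappa : nat).
Hypothesis pol : polarity (form_bilin f) (form_sing f) kappa.
Hypothesis ps : polar_space (form_bilin f) (form_sing f) U D.
Hypothesis D_gt0 : (0 < D)%N.
Local Notation gens := (gens (form_bilin f) (form_sing f) U D).
Local Notation s := (polar_order kappa U D).
Local Notation Omega1 := (Omega f U 1).
Implicit Types (G H W T l : {vspace V}).

Definition disjoint_count : nat := (\prod_(i < D) (s * q ^ i))%N.
(** The constant c of the overview ([card_gens_through_disjoint]), while [disjoint_count] is the row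
    sum of K. *)
Definition disjoint_through_count : nat := (\prod_(i < D.-1) (s * q ^ i))%N.

Lemma disjoint_count_gt0 : (0 < disjoint_count)%N.
Proof.
have q0 : (0 < q)%N := ltnW (finNzRing_gt1 F).
apply: prodn_gt0 => i; rewrite !muln_gt0 expn_gt0 q0 (polarity_gt0 pol) /=.
by rewrite expn_gt0 q0.
Qed.

Lemma val_gens (G : omega f U D) : val G \in gens.
Proof. by rewrite -OmegaE; apply: valP. Qed.

Lemma card_gens_disjoint G : G \in gens ->
  #|[set H in gens | (H :&: G == 0)%VS]| = disjoint_count.
Proof.
by move=> Gg; apply: (card_gens_meet pol ps Gg (sub0v G)); rewrite dimv0.
Qed.

Lemma line_generator l : l \in Omega1 ->
  exists x, [/\ l = <[x]>%VS, x != 0, x \in U & form_sing f x].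
Proof.
rewrite (OmegaE f U 1) => /(gensP) [lU tl dl].
exists (vpick l); have l0 : vpick l != 0 by rewrite vpick0 -dimv_eq0 dl.
split=> //; last exact: ts_sing pol _ _ tl (memv_pick l).
  by apply/esym/eqP; rewrite eqEdim -memvE memv_pick dim_vline l0 dl.
exact: (subvP lU) (memv_pick l).
Qed.

Lemma incident_line l G : l \in Omega1 -> G \in gens ->
  incident l G = (l <= G)%VS.
Proof.
rewrite (OmegaE f U 1) => /gensP [_ _ dl] /gensP [_ _ dG].
rewrite /incident; case: (boolP (l <= G)%VS) => //= lG; apply/negP => Gl.
by case/negP: lG; have /eqP -> : G == l by rewrite eqEdim Gl dl dG.
Qed.

Lemma card_gens_through l : l \in Omega1 ->
  #|[set H in gens | (l <= H)%VS]| = (\prod_(i < D.-1) (s * q ^ i + 1))%N.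
Proof.
move=> /[dup] /line_generator[x [_ _ _ _]]; rewrite (OmegaE f U 1) => /gensP[lU tl dl].
by apply: (card_gens_over pol ps lU tl); rewrite dl add1n prednK.
Qed.

(** For [x] outside [G], [meet_gen_through] with [S = 0] identifies the generators through [x]
    disjoint from [G] with those meeting the generator spanned by [x] and [G :&: perp <[x]>] in
    [<[x]>] only; [card_gens_meet] counts the latter. *)
Lemma card_gens_through_disjoint l G : l \in Omega1 -> G \in gens ->
  #|[set H in gens | (l <= H)%VS && (H :&: G == 0)%VS]| =
  (if (l <= G)%VS then 0 else disjoint_through_count)%N.
Proof.
move=> /line_generator[x [-> x0 xU sx]] Gg; rewrite -memvE.
have [xG|xG] := boolP (x \in G).
  apply/eqP; rewrite cards_eq0 -subset0; apply/subsetP => H.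
  rewrite !inE => /and3P[_]; rewrite -memvE => xH /eqP HG.
  by case/negP: x0; rewrite -memv0 -HG memv_cap xH.
have Gx := gen_through pol ps Gg xU sx xG.
have xG' : (<[x]> <= G :&: perp (form_bilin f) <[x]> + <[x]>)%VS by exact: addvSr.
have dx : (\dim <[x]> + D.-1)%N = D by rewrite dim_vline x0 add1n prednK.
rewrite /disjoint_through_count -(card_gens_meet pol ps Gx xG' dx); apply: eq_card => H.
rewrite inE [RHS]inE; case Hg : (H \in gens) => //=.
have x_perp0 : x \in perp (form_bilin f) 0%VS.
  by rewrite memvE (perpC pol) sub0v.
by rewrite -memvE (meet_gen_through pol Gg Hg xU sx xG (sub0v G) x_perp0) add0v.
Qed.


(** Membership in the span of [j] and [Im C_{1,D}], with explicit coefficients; [theta] is read only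
    at the points of the polar space. *)
Definition affine (a : R) (theta : {vspace V} -> R)
    (phi : {ffun omega f U D -> R^o}) : Prop :=
  forall G : omega f U D, phi G = a + \sum_(l in Omega1 | (l <= val G)%VS) theta l.

Lemma disjointnessE (phi : {ffun omega f U D -> R^o}) (g : {vspace V} -> R) :
  (forall G : omega f U D, phi G = g (val G)) ->
  forall G : omega f U D, disjointness R f U D phi G =
    \sum_(H in gens | (H :&: val G == 0)%VS) g H.
Proof.
move=> phiE G; rewrite lfunE ffunE -(OmegaE f U D) -sum_omega.
by apply: eq_bigr => H _.
Qed.

(** A point contributes [disjoint_through_count] times its weight if it is off [G] and nothing if it
    is on [G]. The sum over the points off [G] is the total minus [phi G - a], so K acts as a
    constant minus a multiple of [phi]. *)
Lemma disjointness_affine a theta phi : affine a theta phi ->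
  forall G : omega f U D, disjointness R f U D phi G =
    a * disjoint_count%:R + disjoint_through_count%:R * (a + \sum_(l in Omega1) theta l)
    - disjoint_through_count%:R * phi G.
Proof.
move=> phiE G; have Gg := val_gens G.
rewrite (@disjointnessE phi (fun G => a + \sum_(l in Omega1 | (l <= G)%VS) theta l) phiE)
  big_split /= sumr_const.
have -> : a *+ #|[pred H in gens | (H :&: val G == 0)%VS]| = a * disjoint_count%:R.
  rewrite -(card_gens_disjoint Gg) mulr_natr; congr (_ *+ _).
  by apply: eq_card => H; rewrite !inE.
rewrite -addrA; congr (_ + _).
rewrite (exchange_big_dep (mem Omega1)) /=; last by move=> H l _ /andP[].
rewrite phiE -mulrBr [X in _ * (a + X - _)](bigID (fun l => (l <= val G)%VS)) /=.
have cancel (u v w : R) : u + (v + w) - (u + v) = w by ring.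
rewrite cancel mulr_sumr.
rewrite [LHS](bigID (fun l => (l <= val G)%VS)) /= big1 ?add0r.
  apply: eq_bigr => l /andP[lO lG]; rewrite sumr_const mulr_natl; congr (_ *+ _).
  have := card_gens_through_disjoint lO Gg; rewrite (negPf lG) => <-.
  by apply: eq_card => H; rewrite [RHS]inE unfold_in /= lO;
    case: (H \in gens); case: (l <= H)%VS; rewrite /= ?andbT ?andbF.
move=> l /andP[lO lG]; rewrite big_pred0 // => H.
have := card_gens_through_disjoint lO Gg; rewrite lG => /eqP; rewrite cards_eq0.
by move/eqP/setP/(_ H); rewrite inE in_set0 lO;
  case: (H \in gens); case: (l <= H)%VS; rewrite /= ?andbT ?andbF.
Qed.

Lemma Omega_above (a : int) W : D%:Z < a -> W \notin Omega f U a.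
Proof.
move=> Da; apply/negP; rewrite inE totally_singularE => /and3P[WU tW /eqP dW].
by have := polar_rank_le ps WU tW; rewrite -lez_nat dW leNgt Da.
Qed.

(** Constants come from the unique 0-space and from the identity incidence on generators; the two
    orthogonality conditions concern [Omega] in dimensions -1 and [D + 1], both empty. *)
Lemma constant_in_V0 (c : R) :
  ([ffun=> c] : {ffun omega f U D -> R^o}) \in Vspace R f U D D 0 0.
Proof.
have from_const a : (forall T : omega f U D,
    #|[set W in Omega f U a | incident W (val T)]| = 1%N) ->
    ([ffun=> c] : {ffun omega f U D -> R^o}) \in limg (incidence R f U a D).
  move=> h; have -> : [ffun=> c] = incidence R f U a D [ffun=> c].
    by apply/ffunP => T; rewrite incidence_const h ffunE.
  exact: memv_img (memvf _).
have orth_empty a (u : {ffun omega f U D -> R^o}) :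
    (forall W, W \notin Omega f U a) -> u \in orthocompl (limg (incidence R f U a D)).
  move=> e; apply/mem_orthocompl => v /memv_imgP[phi _ ->].
  by rewrite incidence_empty // ffdot0r.
rewrite /Vspace !memv_cap -!andbA; apply/and4P; split.
- apply: from_const => T; apply: (eq_card1 (x := 0%VS)) => W.
  rewrite in_set mem_Omega0 inE.
  by case: eqP => [->|//]; rewrite /incident sub0v.
- by apply: orth_empty => W; rewrite inE; apply/negP => /and3P[_ _].
- apply: from_const => T; apply: (eq_card1 (x := val T)) => W.
  rewrite in_set subr0 [RHS]inE.
  have dT : \dim (val T) = D by have /gensP[] := val_gens T.
  apply/andP/eqP => [[]|->].
    move=> WO; have /gensP[_ _ dW] : W \in gens by rewrite -OmegaE.
    by rewrite incident_same_dim ?dT // => /eqP.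
  by rewrite (valP T) /incident subvv.
- by apply: orth_empty => W; apply: Omega_above; rewrite subr0 ltzD1.
Qed.

Lemma incidence1_affine (psi : {ffun omega f U 1 -> R^o}) :
  affine 0 (extend_omega psi) (incidence R f U 1 D psi).
Proof.
move=> G; rewrite incidence_extend add0r; apply: eq_bigl => l.
case lO : (l \in Omega1) => //=; apply: incident_line => //.
exact: val_gens.
Qed.

Lemma sum_affine0 theta phi : affine 0 theta phi ->
  \sum_G phi G = (\prod_(i < D.-1) (s * q ^ i + 1))%:R * \sum_(l in Omega1) theta l.
Proof.
move=> phiE.
transitivity (\sum_(G in gens) \sum_(l in Omega1 | (l <= G)%VS) theta l).
  rewrite -OmegaE [RHS]big_sub; apply: eq_bigr => G _.
  by rewrite phiE add0r.
rewrite (exchange_big_dep (mem Omega1)) /=; last by move=> H l _ /andP[].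
rewrite mulr_sumr; apply: eq_bigr => l lO; rewrite sumr_const mulr_natl.
rewrite -(card_gens_through lO); congr (_ *+ _).
by apply: eq_card => H; rewrite [RHS]inE unfold_in /= lO.
Qed.

Lemma V1_disjointness :
  (Vspace R f U D D 1 0 <=
     passmx.leigenspace (disjointness R f U D) (- disjoint_through_count%:R))%VS.
Proof.
apply/subvP => phi; rewrite /Vspace !memv_cap -!andbA => /and4P[].
case/memv_imgP=> psi _ -> /mem_orthocompl orth _ _.
have aff := incidence1_affine psi.
set phi' := incidence R f U 1 D psi in orth aff *.
(* Elements of [V_1] are orthogonal to the all-ones vector; as every point lies on equally many
   generators, the total weight vanishes and with it the constant term of [disjointness_affine]. *)
have sum0 : \sum_(l in Omega1) extend_omega psi l = 0.
  have /orth : ([ffun=> 1] : {ffun omega f U D -> R^o}) \in limg (incidence R f U (1 - 1) D).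
    by have := constant_in_V0 1; rewrite /Vspace !memv_cap -!andbA subrr => /and4P[].
  rewrite /ffdot (eq_bigr phi') => [|G _]; last by rewrite ffunE mulr1.
  rewrite (sum_affine0 aff) => /eqP; rewrite mulf_eq0 => /orP[|/eqP //].
  by rewrite pnatr_eq0 -leqn0 leqNgt prodn_gt0 // => i; rewrite addn1.
apply/mem_leigenspace => G; rewrite (disjointness_affine aff) sum0.
by rewrite mul0r addr0 mulr0 !add0r mulNr.
Qed.

Lemma affine_cameron_liebler (L : {set {vspace V}}) a theta :
  L \subset gens -> affine a theta (charvec R f U D L) ->
  cameron_liebler R f U D L.
Proof.
move=> sL aff; split; first by rewrite OmegaE.
exists (- disjoint_through_count%:R); first exact: V1_disjointness.
pose c : R := disjoint_through_count%:R; pose k : R := disjoint_count%:R.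
(* With [k] the row sum of K, [b] solves the equation saying that the characteristic vector minus
   [b] times [j] is an eigenvector of K for [- c]. *)
pose b := (a * k + c * (a + \sum_(l in Omega1) theta l)) / (k + c).
have kc : k + c != 0 by rewrite -natrD pnatr_eq0 -lt0n addn_gt0 disjoint_count_gt0.
pose j : {ffun omega f U D -> R^o} := [ffun=> b].
rewrite -(addrNK j (charvec R f U D L)) addrC.
apply: memv_add; first exact: constant_in_V0.
have aff_j : affine b (fun=> 0) j by move=> G; rewrite ffunE big1 ?addr0.
apply/mem_leigenspace => G.
have -> : disjointness R f U D (charvec R f U D L - j) G =
    disjointness R f U D (charvec R f U D L) G - disjointness R f U D j G.
  by rewrite linearB /= [LHS]ffunE [X in _ + X]ffunE.
have -> : (charvec R f U D L - j) G = charvec R f U D L G - b.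
  by rewrite [LHS]ffunE [X in _ + X]ffunE [X in _ - X]ffunE.
have -> : disjointness R f U D j G = b * k.
  rewrite (disjointness_affine aff_j) big1 // addr0 ffunE.
  by rewrite addrK.
rewrite (disjointness_affine aff) -/c -/k; apply/eqP; rewrite -subr_eq0; apply/eqP.
transitivity (a * k + c * (a + \sum_(l in Omega1) theta l) - b * (k + c)); first by ring.
by rewrite divfK // subrr.
Qed.

End Disjointness.

(** * Generators meeting alpha in an element of the ovoid *)

(** The two summands lie in [Im C_{0,a}], which consists of constants, and in [Im C_{1,a}], which
    supplies the point weights [psi]. *)
Lemma type1_charvec (R : realType) (F : finFieldType) (N : nat)
    (f : classical_form 'rV[F]_N) (U : {vspace 'rV[F]_N}) (a i1 i2 : int)
    (D : nat) (M : {set {vspace 'rV[F]_N}}) :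
  charvec R f U a M \in (Vspace R f U D a 0 i1 + Vspace R f U D a 1 i2)%VS ->
  exists a0 (psi : {vspace 'rV[F]_N} -> R), forall W, W \in Omega f U a ->
    (W \in M)%:R = a0 + \sum_(l in Omega f U 1 | incident l W) psi l.
Proof.
case/memv_addP => u u0 [v v1 e].
have /memv_imgP[phi _ uE] : u \in limg (incidence R f U 0 a).
  by move: u0; rewrite /Vspace !memv_cap -!andbA => /and4P[].
have /memv_imgP[psi _ vE] : v \in limg (incidence R f U 1 a).
  by move: v1; rewrite /Vspace !memv_cap -!andbA => /and4P[].
exists (extend_omega phi 0%VS), (extend_omega psi) => W WO.
have := congr1 (fun g : {ffun omega f U a -> R^o} => g (exist _ W WO)) e.
by rewrite /= !ffunE /= uE vE incidence_from0 ffunE incidence_extend.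
Qed.

(** * Generators of P and their intersections with [alpha] *)

Section Extension.
Variables (F : finFieldType) (n d kappa m : nat).
Local Notation V := 'rV[F]_(n.+4).
Local Notation q := #|F|.
Variables (f : classical_form V) (alpha : {vspace V}) (M : {set {vspace V}}).
Hypothesis pol : polarity (form_bilin f) (form_sing f) kappa.
Hypothesis psU : polar_space (form_bilin f) (form_sing f) fullv d.+2.
Hypothesis psA : polar_space (form_bilin f) (form_sing f) alpha d.
Hypothesis d_gt1 : (1 < d)%N.
Hypothesis dim_alpha : \dim alpha = n.+1.
Hypothesis MO : ovoid f alpha d m M.
Local Notation gensU := (gens (form_bilin f) (form_sing f) fullv d.+2).
Local Notation gensA := (gens (form_bilin f) (form_sing f) alpha d).
Local Notation s := (polar_order kappa (fullv : {vspace V}) d.+2).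
Local Notation s' := (polar_order kappa alpha d).
Local Notation geom k := (\sum_(i < k) q ^ i)%N.
Implicit Types (G H W T l : {vspace V}).

Let L := [set G in Omega f fullv d.+2 |
            (\dim (G :&: alpha) == d.-1) && ((G :&: alpha)%VS \in M)].

Lemma cap_gens G : G \in gensU ->
  (G :&: alpha)%VS \in gens (form_bilin f) (form_sing f) alpha (\dim (G :&: alpha)).
Proof.
case/gensP=> _ tG _; apply/gensP; split=> //; first exact: capvSr.
exact: (tsS pol (capvSl _ _)).
Qed.

(** [alpha] has codimension 3, so a space of dimension [d + 2] meets it in dimension at least
    [d - 1]; the rank of P' bounds the dimension by [d]. *)
Lemma dim_cap_alpha G : G \in gensU ->
  \dim (G :&: alpha) = d.-1 \/ (G :&: alpha)%VS \in gensA.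
Proof.
case/gensP=> _ tG dG.
have tGa : ts (form_bilin f) (form_sing f) (G :&: alpha)%VS.
  exact: (tsS pol (capvSl _ _)).
have le := polar_rank_le psA (capvSr G alpha) tGa.
have sum_cap := dimv_sum_cap G alpha.
have : (\dim (G + alpha) <= n.+4)%N.
  by rewrite (leq_trans (dimvS (subvf _))) // dimvf /dim /= mul1n.
have [e|ne] := eqVneq (\dim (G :&: alpha)) d.
  by move=> _; right; apply/gensP; rewrite capvSr.
by move=> ?; left; lia.
Qed.

Lemma Omega_pred W : (W \in Omega f alpha (d%:Z - 1)) =
  (W \in gens (form_bilin f) (form_sing f) alpha d.-1).
Proof. by rewrite -OmegaE predn_int ?(ltnW d_gt1). Qed.

Lemma ovoid_gens W : W \in M -> W \in gens (form_bilin f) (form_sing f) alpha d.-1.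
Proof. by move=> WM; rewrite -Omega_pred (subsetP MO.1). Qed.

Lemma mem_ext G : (G \in L) = (G \in gensU) && ((G :&: alpha)%VS \in M).
Proof.
rewrite inE OmegaE; congr (_ && _); apply/andP/idP => [[] //|GM]; split=> //.
by have /gensP[_ _ ->] := ovoid_gens GM.
Qed.

(** Double count of the pairs [W <= T] with [W] in [M] and [T] a generator of P': each [W] lies in
    [s' + 1] generators, each [T] contains [m] elements of [M]. *)
Lemma card_ovoid : (#|M| * (s' + 1) = m * \prod_(i < d) (s' * q ^ i + 1))%N.
Proof.
have <- : #|gensA| = (\prod_(i < d) (s' * q ^ i + 1))%N.
  rewrite -(@card_gens_over _ _ _ _ _ pol _ _ psA 0%VS) ?sub0v ?dimv0 //.
    by apply: eq_card => G; rewrite [RHS]inE sub0v andbT.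
  have [W WA [tW _]] := polar_rank_ex psA.
  exact: (tsS pol (sub0v W) tW).
transitivity (\sum_(W in M) \sum_(T in gensA | (W <= T)%VS) 1)%N.
  rewrite -sum_nat_const; apply: eq_bigr => W WM.
  have /gensP[WA tW dW] := ovoid_gens WM.
  have dW1 : (\dim W + 1 = d)%N by rewrite dW addn1 prednK // ltnW.
  have := card_gens_over pol psA WA tW dW1.
  rewrite sum1_card big_ord_recr big_ord0 /= expn0 muln1 mul1n => <-.
  by apply: eq_card => T; rewrite in_set.
rewrite (exchange_big_dep (mem gensA)) /=; last by move=> W T _ /andP[].
rewrite mulnC -sum_nat_const; apply: eq_bigr => T TA.
have TO : T \in Omega f alpha d by rewrite OmegaE.
rewrite -(MO.2 T TO) sum1_card; apply: eq_card => W.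
by rewrite [RHS]in_set unfold_in /= [T \in _]TA.
Qed.

(** The right side counts all generators of P through [W]. Those not meeting [alpha] exactly in [W]
    meet it in one of the [s' + 1] generators of P' through [W], each of which lies in
    [(s + 1) * (s * q + 1)] generators of P. *)
Lemma card_gens_over_hyperplane W :
  W \in gens (form_bilin f) (form_sing f) alpha d.-1 ->
  (#|[set G in gensU | (G :&: alpha == W)%VS]| +
     (s' + 1) * ((s + 1) * (s * q + 1)) =
   (s + 1) * (s * q + 1) * (s * q ^ 2 + 1))%N.
Proof.
case/gensP=> WA tW dW.
have d1 : (0 < d)%N by exact: ltnW.
have dW3 : (\dim W + 3 = d.+2)%N by rewrite dW; lia.
have dW1 : (\dim W + 1 = d)%N by rewrite dW; lia.
have := card_gens_over pol psU (subvf W) tW dW3.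
rewrite !big_ord_recr big_ord0 /= expn0 expn1 muln1 mul1n => <-.
rewrite -[RHS](cardsID [set G | (G :&: alpha == W)%VS]); congr (_ + _)%N.
  apply: eq_card => G; rewrite [LHS]in_set [RHS]in_setI mem_gens_over.
  rewrite [X in _ = _ && X]in_set; case: eqP => [<-|]; rewrite ?andbF //.
  by rewrite capvSl !andbT.
have := card_gens_over pol psA WA tW dW1.
rewrite big_ord_recr big_ord0 /= expn0 muln1 mul1n => <-.
rewrite -sum_nat_const.
rewrite -[RHS]sum1_card [RHS](partition_big (fun G => (G :&: alpha)%VS)
  (mem (gens_over (form_bilin f) (form_sing f) alpha d W))) /=; last first.
  move=> G; rewrite in_setD mem_gens_over [X in ~~ X]in_set => /andP[ne /andP[Gg WG]].
  have le : (W <= G :&: alpha)%VS by rewrite subv_cap WG WA.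
  rewrite mem_gens_over le andbT; case: (dim_cap_alpha Gg) => // dGa.
  by case/negP: ne; rewrite eq_sym eqEdim le dGa dW leqnn.
apply: eq_bigr => T; rewrite mem_gens_over => /andP[TA WT].
have /gensP[Ta tT dT] := TA.
have dT2 : (\dim T + 2 = d.+2)%N by rewrite dT addn2.
rewrite sum1_card.
have := card_gens_over pol psU (subvf T) tT dT2.
rewrite !big_ord_recr big_ord0 /= expn0 expn1 muln1 mul1n => <-.
apply: eq_card => G; rewrite [RHS]unfold_in /= in_setD !mem_gens_over.
rewrite [X in ~~ X]in_set; have [Gg|] := boolP (G \in gensU); rewrite ?andbF //=.
have [TG|TG] := boolP (T <= G)%VS; last first.
  by case: (eqVneq (G :&: alpha)%VS T) TG => [<-|_ _]; rewrite ?capvSl ?andbF.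
have -> : (G :&: alpha)%VS = T.
  apply/esym/eqP; rewrite eqEdim subv_cap TG Ta dT /=.
  have /gensP[_ tG _] := Gg.
  have tGa := tsS pol (capvSl G alpha) tG.
  have le := polar_rank_le psA (capvSr G alpha) tGa. exact: le.
rewrite eqxx (subv_trans WT TG) !andbT; apply/esym/eqP => TW.
by have := dT; rewrite TW dW; lia.
Qed.

Lemma card_ext :
  (#|L| + #|M| * ((s' + 1) * ((s + 1) * (s * q + 1))) =
   #|M| * ((s + 1) * (s * q + 1) * (s * q ^ 2 + 1)))%N.
Proof.
have -> : #|L| = (\sum_(W in M) #|[set G in gensU | (G :&: alpha == W)%VS]|)%N.
  rewrite -sum1_card (partition_big (fun G => (G :&: alpha)%VS) (mem M)) /=.
    apply: eq_bigr => W WM; rewrite sum1_card; apply: eq_card => G.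
    rewrite [RHS]in_set unfold_in /= mem_ext; case: eqP => [->|]; rewrite ?andbF //.
    by rewrite WM !andbT.
  by move=> G; rewrite mem_ext => /andP[].
rewrite -!sum_nat_const -big_split /=; apply: eq_bigr => W WM.
exact: card_gens_over_hyperplane (ovoid_gens WM).
Qed.


Lemma card_gens_between S T k : (S <= T)%VS -> T \in gensA -> (\dim S + k = d)%N ->
  #|[set W in gens (form_bilin f) (form_sing f) alpha d.-1 |
      (S <= W)%VS && (W <= T)%VS]| = geom k.
Proof.
move=> ST /gensP[Ta tT dT] dS; rewrite -(card_hyperplanes ST) ?dT //.
apply: eq_card => W; rewrite [LHS]in_set [RHS]in_set andbC -andbA; congr (_ && _).
apply/andP/andP => [[WT /gensP[_ _ dW]]|[WT /eqP dW]]; split=> //.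
  by rewrite dW prednK // ltnW.
apply/gensP; split; [exact: subv_trans WT Ta|exact: (tsS pol WT tT)|].
by rewrite -dW.
Qed.

Lemma card_lines_gens U D k W :
  W \in gens (form_bilin f) (form_sing f) U D -> (\dim W = k)%N ->
  #|[set l in Omega f U 1 | (l <= W)%VS]| = geom k.
Proof.
move=> /gensP[WU tW _] <-; rewrite -card_lines; apply: eq_card => l.
rewrite [LHS]in_set [RHS]in_set (OmegaE f U 1) andbC; case lW: (l <= W)%VS => //=.
apply/gensP/eqP => [[]|dl] //; split=> //; first exact: subv_trans lW WU.
exact: (tsS pol lW tW).
Qed.

(** * The characteristic vector of [L] in terms of points *)

Section Characteristic.
Variables (R : realType) (a0 : R) (psi : {vspace V} -> R).
Hypothesis M_psi : forall W, W \in Omega f alpha (d%:Z - 1) ->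
  (W \in M)%:R = a0 + \sum_(l in Omega f alpha 1 | incident l W) psi l.

Lemma M_lines W : W \in gens (form_bilin f) (form_sing f) alpha d.-1 ->
  (W \in M)%:R = a0 + \sum_(l in Omega f alpha 1 | (l <= W)%VS) psi l.
Proof.
move=> Wg; rewrite M_psi ?Omega_pred //; congr (_ + _); apply: eq_bigl => l.
case lO : (l \in _) => //=; apply: incident_line Wg => //.
(* Elements of [M] have positive dimension as [1 < d], so incidence with a point means containing
   it. *)
by rewrite -ltnS prednK // ltnW.
Qed.

(* Sum the values of the characteristic function of M over the hyperplanes of T. *)
Lemma sum_lines_gens T : T \in gensA ->
  m%:R = a0 * (geom d)%:R + (geom d.-1)%:R * \sum_(l in Omega f alpha 1 | (l <= T)%VS) psi l.
Proof.
move=> Tg; have TO : T \in Omega f alpha d by rewrite OmegaE.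
pose g := gens (form_bilin f) (form_sing f) alpha d.-1.
transitivity (\sum_(W in g | (W <= T)%VS) (W \in M)%:R : R).
  rewrite -(MO.2 T TO) -sum1_card natr_sum big_mkcond [RHS]big_mkcond /=.
  apply: eq_bigr => W _; rewrite in_set; case WM : (W \in M); last by case: ifP.
  by rewrite (ovoid_gens WM).
rewrite (eq_bigr (fun W => a0 + \sum_(l in Omega f alpha 1 | (l <= W)%VS) psi l)); last first.
  by move=> W /andP[Wg _]; apply: M_lines.
rewrite big_split /= sumr_const; congr (_ + _).
  rewrite mulr_natr -(card_gens_between (sub0v T) Tg) ?dimv0 //; congr (_ *+ _).
  by apply: eq_card => W; rewrite [RHS]in_set sub0v.
rewrite (exchange_big_dep (fun l => (l \in Omega f alpha 1) && (l <= T)%VS)) /=; last first.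
  by move=> W l /andP[_ WT] /andP[-> lW]; apply: subv_trans lW WT.
rewrite mulr_sumr; apply: eq_bigr => l /andP[lO lT]; rewrite sumr_const mulr_natl.
have dl : (\dim l + d.-1 = d)%N.
  have := lO; rewrite (OmegaE f alpha 1) => /gensP[_ _ ->].
  by rewrite add1n prednK // ltnW.
rewrite -(card_gens_between lT Tg dl); congr (_ *+ _).
apply: eq_card => W; rewrite [RHS]in_set unfold_in /= lO /=.
by rewrite -andbA [X in _ && X]andbC.
Qed.

Lemma ext_affine : exists a theta, affine a theta (charvec R f fullv d.+2 L).
Proof.
(* The sum of [psi] over the points of any generator of P', solved from [sum_lines_gens]. *)
pose s0 : R := (m%:R - a0 * (geom d)%:R) / (geom d.-1)%:R.
(* Points of [alpha] get weight [psi l + c], and [c * (geom d.-1)%:R] is subtracted from [a0]. If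
   [G] meets [alpha] in dimension [d - 1], the correction cancels; in dimension [d] the value is
   [a0 + s0 + c * q ^ (d - 1)], and [c] makes this 0. *)
pose c : R := - (a0 + s0) / q%:R ^+ d.-1.
have q0 : q%:R != 0 :> R by rewrite pnatr_eq0 -lt0n (ltnW (finNzRing_gt1 F)).
have geom_gt0 : (geom d.-1)%:R != 0 :> R.
  rewrite pnatr_eq0 -lt0n; case: d d_gt1 => [|[|k]] // _.
  by rewrite big_ord_recl expn0.
have geomS : geom d = (geom d.-1 + q ^ d.-1)%N.
  by case: d d_gt1 => // k _; rewrite big_ord_recr.
exists (a0 - c * (geom d.-1)%:R), (fun l => if (l <= alpha)%VS then psi l + c else 0).
move=> G; have Gg : val G \in gensU by rewrite -OmegaE; apply: valP.
have -> : \sum_(l in Omega f fullv 1 | (l <= val G)%VS)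
      (if (l <= alpha)%VS then psi l + c else 0) =
    \sum_(l in Omega f alpha 1 | (l <= val G :&: alpha)%VS) psi l
    + c * (geom (\dim (val G :&: alpha)))%:R.
  rewrite -big_mkcondr /=.
  rewrite (eq_bigl (fun l => (l \in Omega f alpha 1) && (l <= val G :&: alpha)%VS)).
    rewrite big_split /=; congr (_ + _); rewrite sumr_const mulr_natr.
    rewrite -(card_lines_gens (cap_gens Gg) (erefl _)); congr (_ *+ _).
    by apply: eq_card => l; rewrite [RHS]in_set.
  move=> l; rewrite subv_cap !in_set subvf; case: (l <= alpha)%VS; rewrite ?andbT ?andbF //.
rewrite ffunE mem_ext Gg /=; case: (dim_cap_alpha Gg) => [dGa|Ga].
  rewrite dGa M_lines; first by ring.
  by rewrite -dGa; apply: cap_gens.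
have -> : (val G :&: alpha)%VS \in M = false.
  by apply/negP => /ovoid_gens /gensP[_ _]; have /gensP[_ _ ->] := Ga; lia.
have := sum_lines_gens Ga; set S := \sum_(l in _ | _) _ => mE.
have -> : S = s0 by rewrite /s0 mE addrC addKr mulrC mulKf.
have /gensP[_ _ ->] := Ga.
rewrite geomS natrD natrX mulrDr /= [c * _ ^+ _]divfK ?expf_neq0 //; ring.
Qed.

End Characteristic.
End Extension.

(** * The Cameron-Liebler property and the parameter of [L] *)

Theorem theorem6p2 (R : realType) (F : finFieldType) (d n m : nat)
    (f : classical_form 'rV[F]_(n.+4)) (alpha : {vspace 'rV[F]_(n.+4)})
    (t t' : polar_family) (M : {set {vspace 'rV[F]_(n.+4)}}) :
  (2 <= d)%N ->
  classical_polar_space f fullv t d.+2 ->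
  polar_parameter R t <= 1 ->
  \dim alpha = n.+1 ->
  classical_polar_space f alpha t' d ->
  polar_parameter R t' = polar_parameter R t + 1 ->
  regular_ovoid_of_type R f alpha d m 1 M ->
  let q : R := #|F|%:R in
  let e : R := polar_parameter R t in
  let L := [set G in Omega f fullv d.+2 |
              (\dim (G :&: alpha) == d.-1) && ((G :&: alpha)%VS \in M)] in
  cameron_liebler R f fullv d.+2 L /\
  cl_parameter R t d.+2 L = m%:R * q `^ (e + 1) * (q - 1).
Proof.
move=> d_gt1 cpU _ dim_alpha cpA et [ovM _ _ chM] q e L.
have [kappa pol pw] := form_polarity f.
have psU := classical_polar pol cpU; have psA := classical_polar pol cpA.
have q_ge0 : 0 <= q by rewrite ler0n.
have q_neq0 : q != 0 by rewrite pnatr_eq0 -lt0n (ltnW (finNzRing_gt1 F)).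
pose s := polar_order kappa (fullv : {vspace 'rV[F]_(n.+4)}) d.+2.
pose s' := polar_order kappa alpha d.
have sE : s%:R = q `^ e.
  by case: cpU => ft _ dU _; rewrite /e (pw R t d.+2 ft) -dU.
have s'E : s' = (s * #|F|)%N.
  apply/eqP; rewrite -(eqr_nat R) natrM sE -[X in _ * X](powRr1 q_ge0) -powRD ?q_neq0 ?implybT //.
  by case: cpA => ft _ dA _; rewrite -et (pw R t' d ft) -dA.
split.
  have [a0 [psi M_psi]] := type1_charvec chM.
  have [a [theta aff]] := ext_affine pol psA d_gt1 dim_alpha ovM M_psi.
  apply: (affine_cameron_liebler pol psU _ _ aff) => //.
  by rewrite -OmegaE; apply/subsetP => G; rewrite inE => /andP[].
have qe1 : q `^ (e + 1) = s%:R * q.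
  by rewrite powRD ?q_neq0 ?implybT // powRr1 // sE.
have cM := card_ovoid pol psA d_gt1 ovM.
have cL := card_ext pol psU psA d_gt1 dim_alpha ovM.
rewrite -/L -/s -/s' in cM cL.
rewrite /cl_parameter qe1 -/q -/e.
have -> : \prod_(i < d.+2.-1) (q `^ (e + i%:R) + 1) =
    (\prod_(i < d.+1) (s * #|F| ^ i + 1))%:R :> R.
  rewrite natr_prod; apply: eq_bigr => i _.
  by rewrite powRD ?q_neq0 ?implybT // powR_mulrn // -sE natrD natrM natrX.
set P := (\prod_(i < d.+1) _)%N.
have P_gt0 : (0 < P)%N by apply: prodn_gt0 => i; rewrite addn1.
(* Splitting off the factor at index 0 and using [s' = s * q] shifts the product for P to the one
   for P' that occurs in [card_ovoid]. *)
have PE : P = ((s + 1) * \prod_(i < d) (s' * #|F| ^ i + 1))%N.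
  rewrite /P big_ord_recl expn0 muln1; congr (_ * _)%N.
  by apply: eq_bigr => i _; rewrite s'E -mulnA -expnS.
(* This says [|L| = m * s * q * (q - 1) * P], written without subtraction of natural numbers. *)
have cLP : (#|L| + m * (s * #|F|) * P = m * (s * #|F|) * #|F| * P)%N.
  rewrite PE; move: cM cL; rewrite s'E.
  move: (\prod_(i < d) _)%N => K cM.
  have -> : (#|M| * ((s * #|F| + 1) * ((s + 1) * (s * #|F| + 1))) =
      m * K * ((s + 1) * (s * #|F| + 1)))%N by rewrite -cM; ring.
  have -> : (#|M| * ((s + 1) * (s * #|F| + 1) * (s * #|F| ^ 2 + 1)) =
      m * K * ((s + 1) * (s * #|F| ^ 2 + 1)))%N by rewrite -cM; ring.
  (* Adding [m * K * (s + 1)] to both sides produces the factors [s * q + 1] and [s * q ^ 2 + 1] of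
     [cL]. *)
  move=> cL; apply/eqP; rewrite -(eqn_add2r (m * K * (s + 1))); apply/eqP.
  transitivity (#|L| + m * K * ((s + 1) * (s * #|F| + 1)))%N; first by ring.
  by rewrite cL; ring.
have P_neq0 : P%:R != 0 :> R by rewrite pnatr_eq0 -lt0n.
have : #|L|%:R = m%:R * (s%:R * q) * q * P%:R - m%:R * (s%:R * q) * P%:R :> R.
  by rewrite /q -!natrM -cLP natrD addrK.
by move=> ->; field.
Qed.
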